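(* For every $\delta>0$ there is $c=c(\delta)>0$ such that the following holds. Let $G$ be a compact vector space over $\mathbb{F}_2$, let $M\ge16$, and let $A\subset G$ be a measurable set of density $\alpha$ such that for every finite subgroup $V\le\widehat G$ with $|V|\le M$, \[ \{\alpha|V|\}\bigl(1-\{\alpha|V|\}\bigr)\ \ge\ \delta\,|V|^{-1}. \] Then $\|\chi_A\|_{A(G)}\ge c\log\log M$.
   Context: A compact vector space over $\mathbb{F}_2$ is a compact Hausdorff abelian group $G$ with $x+x=0$ for all $x$; its dual $\widehat G$ (continuous homomorphisms $G\to S^1$, written additively) is a discrete $\mathbb{F}_2$-vector space. $\mu_G$ is Haar probability measure; the density of $A$ is $\mu_G(A)$. $\widehat f(\gamma)=\int_G f\overline{\gamma}\,d\mu_G$, and $\|f\|_{A(G)}=\sum_{\gamma\in\widehat G}|\widehat f(\gamma)|$ (possibly $+\infty$). $\{t\}$ denotes the fractional part of $t$. *)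

(* Defs.v *)
From HB Require Import structures.
From mathcomp Require Import all_boot all_order all_algebra.
From mathcomp Require Import all_classical all_reals all_analysis.
Set Implicit Arguments. Unset Strict Implicit. Unset Printing Implicit Defensive.
Import Order.TTheory GRing.Theory Num.Theory numFieldTopology.Exports numFieldNormedType.Exports.
Local Open Scope classical_set_scope.
Local Open Scope ring_scope.

Definition ptd (G : topologicalZmodType) : Type := G.
HB.instance Definition _ (G : topologicalZmodType) := Topological.on (ptd G).
HB.instance Definition _ (G : topologicalZmodType) :=
  isPointed.Build (ptd G) (GRing.zero : G).
Notation borel_type G := (g_sigma_algebraType (@open (ptd G))).

Definition is_haar_prob (R : realType) (G : topologicalZmodType)
    (mu : {measure set (borel_type G) -> \bar R}) : Prop :=
  [/\ mu setT = 1%E,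
      (forall (A : set (borel_type G)) (x : G), measurable A ->
          mu [set (y : G) + x | y in A] = mu A),
      (forall (A : set (borel_type G)), measurable A ->
          mu A = ereal_inf [set mu U | U in [set U : set G | open U /\ A `<=` U]]) &
      (forall (U : set G), open U ->
          mu U = ereal_sup [set mu K | K in [set K : set G | compact K /\ K `<=` U]])].

(* Continuous characters G -> S^1.  Since x + x = 0 they take values in
   {1,-1} = S^1 /\ R, so we take them real-valued of modulus one. *)
Definition character (R : realType) (G : topologicalZmodType) (g : G -> R) : Prop :=
  [/\ continuous g,
      (forall x y : G, g (x + y) = g x * g y) &
      (forall x : G, `|g x| = 1)].

Definition fourier (R : realType) (G : topologicalZmodType)
    (mu : {measure set (borel_type G) -> \bar R}) (f : G -> R) (g : G -> R) : \bar R :=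
  (\int[mu]_(x in [set: borel_type G]) (f x * g x)%:E)%E.

Definition Anorm (R : realType) (G : topologicalZmodType)
    (mu : {measure set (borel_type G) -> \bar R}) (f : G -> R) : \bar R :=
  esum (T := (G -> R)) [set g | character g] (fun g => `|fourier mu f g|%E).

(* A finite subgroup V of the dual, given as the (injective) image of a finite
   index type I; |V| = #|I|. *)
Definition finite_dual_subgroup (R : realType) (G : topologicalZmodType)
    (I : finType) (phi : I -> G -> R) : Prop :=
  [/\ injective phi,
      (forall i, character (phi i)),
      (exists k, phi k = (fun _ => 1)) &
      (forall i j, exists k, phi k = (fun x => phi i x * phi j x))].

Definition fracpart (R : realType) (t : R) : R := t - (Num.floor t)%:~R.

(* Main.v *)
Require Import Defs.
From HB Require Import structures.
From mathcomp Require Import all_boot all_order all_algebra.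
From mathcomp Require Import all_classical all_reals all_analysis.
From mathcomp Require Import measurable_realfun ring lra.
Set Implicit Arguments. Unset Strict Implicit. Unset Printing Implicit Defensive.
Import Order.TTheory GRing.Theory Num.Theory numFieldTopology.Exports numFieldNormedType.Exports.
Local Open Scope classical_set_scope.
Local Open Scope ring_scope.

(* Let f be the indicator of A and fh its Fourier transform. Suppose V is a
   finite subgroup of the dual with |V| <= M. Averaging f over the cosets of the
   annihilator of V gives a function f_V with |V| values in [0, 1] whose sum is
   alpha |V|; since t |-> {t}(1 - {t}) is subadditive, the hypothesis yields a
   coset on which f_V = b with b (1 - b) >= delta / (2 |V|^2). The normalised
   indicator h of A (or of its complement) in that coset is a density bounded by
   2 |V|^3 / delta with |<f - f_V, h>| >= 1/2, hence
     sum_(g notin V) |fh g| |hh g| >= 1/4  (over some finite set of g).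
   By Chang's theorem the characters with |hh g| >= 2^-(i+1) lie in a subgroup
   V_i >= V with log |V_i| <= C 4^i (1 + log |V|), so a dyadic decomposition gives
   an i for which the mass of |fh| on V_i \ V is at least (1 + i) / 32. Replacing
   V by V_i multiplies 1 + log |V| by at most B^(1+i) and gains (1 + i) / 32 of
   mass; iterating until |V| > M gives mass c log log M.

   The finite Fourier expansions are complete because characters separate points
   of G. For x0 <> 0 take g = 1_U - 1_(U + x0) with U a small neighbourhood of 0.
   On a finite subgroup H the autocorrelation of g is a nonnegative combination of
   characters of H, all equal to -1 at x0, one of which has weight bounded below
   independently of H; that character is 1 on every w in H at which the
   autocorrelation is nearly maximal. So these w do not generate x0, and a maximal
   subgroup containing them but not x0 is the kernel of a character. *)

(** * Bounded measurable functions and their Haar mean *)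

Definition bdmeas (R : realType) (G : topologicalZmodType) (f : G -> R) : Prop :=
  measurable_fun [set: borel_type G] (f : borel_type G -> R) /\
  exists C, forall x, `|f x| <= C.

Definition mean (R : realType) (G : topologicalZmodType)
    (mu : {measure set (borel_type G) -> \bar R}) (f : G -> R) : R :=
  Rintegral mu [set: borel_type G] (f : borel_type G -> R).

Section BoundedMeasurable.
Variables (R : realType) (G : topologicalZmodType).
Implicit Types f g : G -> R.

Lemma bdmeas_cst (c : R) : bdmeas (fun _ : G => c).
Proof. by split; [exact: measurable_cst|exists `|c|]. Qed.

Lemma bdmeasD f g : bdmeas f -> bdmeas g -> bdmeas (fun x => f x + g x).
Proof.
move=> [mf [C hC]] [mg [D hD]]; split; first exact: measurable_funD.
by exists (C + D) => x; rewrite (le_trans (ler_normD _ _))// lerD.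
Qed.

Lemma bdmeasM f g : bdmeas f -> bdmeas g -> bdmeas (fun x => f x * g x).
Proof.
move=> [mf [C hC]] [mg [D hD]]; split; first exact: measurable_funM.
by exists (C * D) => x; rewrite normrM ler_pM.
Qed.

Lemma bdmeasN f : bdmeas f -> bdmeas (fun x => - f x).
Proof.
move=> [mf [C hC]]; split; first exact: measurable_funN.
by exists C => x; rewrite normrN.
Qed.

Lemma bdmeasB f g : bdmeas f -> bdmeas g -> bdmeas (fun x => f x - g x).
Proof. by move=> hf /bdmeasN; exact: bdmeasD. Qed.

Lemma eq_bdmeas f g : (forall x, f x = g x) -> bdmeas g -> bdmeas f.
Proof. by move=> fg; rewrite (_ : f = g)//; apply/funext. Qed.

Lemma bdmeasX f n : bdmeas f -> bdmeas (fun x => f x ^+ n).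
Proof.
move=> hf; elim: n => [|n ih]; first exact: bdmeas_cst.
by apply: (eq_bdmeas _ (bdmeasM hf ih)) => x; rewrite exprS.
Qed.

Lemma bdmeas_norm f : bdmeas f -> bdmeas (fun x => `|f x|).
Proof.
move=> [mf [C hC]]; split; first exact: measurableT_comp.
by exists C => x; rewrite normr_id.
Qed.

Lemma bdmeas_sum (I : Type) (r : seq I) (P : pred I) (F : I -> G -> R) :
  (forall i, P i -> bdmeas (F i)) -> bdmeas (fun x => \sum_(i <- r | P i) F i x).
Proof.
move=> hF; elim: r => [|i r ih].
  by apply: (eq_bdmeas _ (bdmeas_cst 0)) => x; rewrite big_nil.
have [Pi|nPi] := boolP (P i).
  by apply: (eq_bdmeas _ (bdmeasD (hF _ Pi) ih)) => x; rewrite big_cons Pi.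
by apply: (eq_bdmeas _ ih) => x; rewrite big_cons (negbTE nPi).
Qed.

Lemma bdmeas_indic (A : set (borel_type G)) :
  measurable A -> bdmeas (\1_A : G -> R).
Proof.
move=> mA; split; first exact: measurable_indic.
by exists 1 => x; rewrite indicE normr_nat (ler_nat _ _ 1) leq_b1.
Qed.

Lemma open_borel (U : set G) : open U -> measurable (U : set (borel_type G)).
Proof. by move=> oU; apply: sub_sigma_algebra. Qed.

Lemma closed_borel (K : set G) : closed K -> measurable (K : set (borel_type G)).
Proof.
by move=> cK; have := measurableC (open_borel (closed_openC cK)); rewrite setCK.
Qed.

Lemma continuous_measurable_borel f :
  continuous f -> measurable_fun [set: borel_type G] (f : borel_type G -> R).
Proof.
move=> cf; apply: (measurability _ (RGenOpens.measurableE R)).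
move=> _ [_ [a [b ->] <-]]; rewrite setTI.
apply: open_borel; apply: open_comp; last exact: interval_open.
by move=> x _; exact: cf.
Qed.

Lemma shift_continuous (x : G) : continuous (fun y : G => y + x).
Proof.
move=> y; apply: (@continuous_comp _ _ _ (fun y : G => (y, x))
  (fun z : G * G => z.1 + z.2)); last exact: add_continuous.
by apply: cvg_pair => /=; [exact: cvg_id|exact: cvg_cst].
Qed.

Lemma measurable_shift (x : G) :
  measurable_fun [set: borel_type G] (fun y : borel_type G => (y : G) + x : borel_type G).
Proof.
apply: (@measurability _ _ (borel_type G) (borel_type G) _ _ (@open (ptd G)) erefl).
move=> _ [U oU <-]; rewrite setTI.
apply: open_borel; apply: open_comp => // y _; exact: shift_continuous.
Qed.

Lemma bdmeas_shift f x : bdmeas f -> bdmeas (fun y => f (y + x)).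
Proof.
move=> [mf [C hC]]; split; last by exists C.
exact: (measurableT_comp mf (measurable_shift x)).
Qed.

End BoundedMeasurable.

Ltac bdmeas_tac := repeat first
  [ assumption | solve [auto]
  | match goal with
    | |- bdmeas (fun _ => ?c) => exact: bdmeas_cst
    | |- bdmeas (fun x => _ + _) => apply: bdmeasD
    | |- bdmeas (fun x => _ - _) => apply: bdmeasB
    | |- bdmeas (fun x => - _) => apply: bdmeasN
    | |- bdmeas (fun x => _ * _) => apply: bdmeasM
    | |- bdmeas (fun x => _ ^+ _) => apply: bdmeasX
    | |- bdmeas (fun x => `| _ |) => apply: bdmeas_norm
    | |- bdmeas (fun x => \sum_(_ <- _ | _) _) => apply: bdmeas_sum => ? ?
    end].

Section Mean.
Variables (R : realType) (G : topologicalZmodType).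
Variable mu : {measure set (borel_type G) -> \bar R}.
Hypothesis haar : is_haar_prob mu.
Implicit Types f g : G -> R.
Local Notation I := (mean mu).

Lemma bdmeas_integrable f : bdmeas f ->
  mu.-integrable [set: borel_type G] (EFin \o (f : borel_type G -> R)).
Proof.
move=> [mf [C hC]]; apply: measurable_bounded_integrable => //.
  by have [-> _ _ _] := haar; rewrite ltry.
exists C; split; first exact: num_real.
by move=> D CD x _ /=; rewrite (le_trans (hC x))// ltW.
Qed.

Lemma meanE f : bdmeas f ->
  (\int[mu]_(x in [set: borel_type G]) (f x)%:E)%E = (I f)%:E.
Proof.
move=> hf; rewrite /mean /Rintegral fineK//.
exact: (integrable_fin_num _ (bdmeas_integrable hf)).
Qed.

Lemma eq_mean f g : (forall x, f x = g x) -> I f = I g.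
Proof. by move=> fg; congr mean; apply/funext. Qed.

Lemma meanD f g : bdmeas f -> bdmeas g -> I (fun x => f x + g x) = I f + I g.
Proof. by move=> hf hg; apply: RintegralD => //; exact: bdmeas_integrable. Qed.

Lemma meanB f g : bdmeas f -> bdmeas g -> I (fun x => f x - g x) = I f - I g.
Proof. by move=> hf hg; apply: RintegralB => //; exact: bdmeas_integrable. Qed.

Lemma meanZ c f : bdmeas f -> I (fun x => c * f x) = c * I f.
Proof. by move=> hf; apply: RintegralZl => //; exact: bdmeas_integrable. Qed.

Lemma mean_cst c : I (fun=> c) = c.
Proof.
by rewrite /mean Rintegral_cst//; have [-> _ _ _] := haar; rewrite mulr1.
Qed.

Lemma le_mean f g : bdmeas f -> bdmeas g -> (forall x, f x <= g x) -> I f <= I g.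
Proof. by move=> hf hg fg; apply: le_Rintegral => //; exact: bdmeas_integrable. Qed.

Lemma mean_ge0 f : (forall x, 0 <= f x) -> 0 <= I f.
Proof. by move=> f0; apply: Rintegral_ge0. Qed.

Lemma norm_mean f : bdmeas f -> `|I f| <= I (fun x => `|f x|).
Proof. by move=> hf; apply: le_normr_Rintegral => //; exact: bdmeas_integrable. Qed.

Lemma mean_sum (J : Type) (r : seq J) (P : pred J) (F : J -> G -> R) :
  (forall i, P i -> bdmeas (F i)) ->
  I (fun x => \sum_(i <- r | P i) F i x) = \sum_(i <- r | P i) I (F i).
Proof.
move=> hF; elim: r => [|i r ih].
  rewrite big_nil -[RHS](mean_cst 0); apply: eq_mean => x; exact: big_nil.
rewrite big_cons; case: ifPn => Pi.
  rewrite -ih -meanD; [|exact: hF|exact: bdmeas_sum].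
  by apply: eq_mean => x; rewrite big_cons Pi.
by rewrite -ih; apply: eq_mean => x; rewrite big_cons (negbTE Pi).
Qed.

Lemma mean_indic (A : set (borel_type G)) : measurable A -> I (\1_A) = fine (mu A).
Proof. by move=> mA; rewrite /mean /Rintegral integral_indic// setIT. Qed.

Lemma mean_shift f x : bdmeas f -> I (fun y => f (y + x)) = I f.
Proof.
move=> hf; congr fine.
pose phi (y : borel_type G) : borel_type G := (y : G) + x.
have mphi : measurable_fun setT phi by exact: measurable_shift.
transitivity (\int[pushforward mu phi]_(y in [set: borel_type G]) (f y)%:E)%E.
  rewrite (@integral_pushforward _ _ _ _ _ phi mphi mu setT (EFin \o f)) //.
    by apply/measurable_EFinP; case: hf.
  exact: (bdmeas_integrable (bdmeas_shift x hf)).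
apply: eq_measure_integral => A mA _; rewrite /pushforward.
have [_ inv _ _] := haar.
rewrite -[RHS](inv A (- x) mA); congr (mu _).
apply/seteqP; split => [y Ay|_ [y Ay <-]].
  by exists ((y : G) + x) => //; rewrite addrK.
by rewrite /phi /preimage /= addrNK.
Qed.

End Mean.

(** * Maximal subgroups avoiding a point in a group of exponent two *)

Section MaximalSubgroup.
Variable G : zmodType.
Hypothesis exp2 : forall x : G, x + x = 0.

Lemma addKK (x y : G) : y + x + x = y.
Proof. by rewrite -addrA exp2 addr0. Qed.

(** Zorn's lemma is applied to the sets [S] such that no finite sum from [W] and [S] equals [x0]. A
    maximal such set absorbs [W] and its own sums; adjoining a point [y] outside it must produce
    [x0], which puts [y + x0] inside. *)
Lemma index_two_subgroup (W : set G) (x0 : G) :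
  (forall ws : seq G, (forall w, w \in ws -> W w) -> \sum_(w <- ws) w != x0) ->
  exists A : set G, [/\ W `<=` A, A 0, (forall x y, A x -> A y -> A (x + y)),
    ~ A x0 & forall y, ~ A y -> A (y + x0)].
Proof.
move=> hW.
pose P (S : set G) := forall ws, (forall w, w \in ws -> W w \/ S w) ->
  \sum_(w <- ws) w != x0.
have [F FP tF|A [PA maxA]] := @Zorn_bigcup _ P.
  move=> ws hws.
  (* A finite list meets finitely many members of the chain, so a single member suffices; [set0]
     covers the case where none is met. *)
  have [S [FS hS]] : exists S, (F S \/ S = set0) /\ forall w, w \in ws -> W w \/ S w.
    elim: ws hws => [|w ws ih] hws.
      by exists set0; split; [right|].
    have [|S [FS hS]] := ih; first by move=> v vws; apply: hws; rewrite inE vws orbT.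
    have [Ww|[T FT Tw]] := hws w (mem_head _ _).
      exists S; split=> // v; rewrite inE => /orP[/eqP->|/hS//]; by left.
    have ST : S `<=` T \/ T `<=` S.
      by case: FS => [FS|->]; [exact: tF|left].
    case: ST => ST.
      exists T; split; first by left.
      move=> v; rewrite inE => /orP[/eqP->|/hS[]]; [by right|by left|by move=> /ST; right].
    exists S; split=> // v; rewrite inE => /orP[/eqP->|/hS//]; right; exact: ST.
  case: FS => [/FP PS|S0]; first exact: PS.
  by apply: hW => w /hS; rewrite S0 => -[].
have maxP y : P (A `|` [set y]) -> A y.
  move=> PAy; apply: contrapT => nAy.
  apply: (maxA _ _ PAy); split; first by move=> x; left.
  by move=> AA; apply: nAy; apply: AA; right.
have genA vs : (forall v, v \in vs -> W v \/ A v) -> A (\sum_(v <- vs) v).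
  move=> hvs; apply: maxP => ws hws.
  have [us [hus ->]] : exists us, (forall u, u \in us -> W u \/ A u) /\
      \sum_(w <- ws) w = \sum_(u <- us) u.
    elim: ws hws => [|w ws ih] hws; first by exists [::].
    have [|us [hus E]] := ih; first by move=> v vws; apply: hws; rewrite inE vws orbT.
    have [Ww|[Aw|wE]] := hws w (mem_head _ _).
    - exists (w :: us); rewrite !big_cons E; split=> // u.
      by rewrite inE => /orP[/eqP->|/hus//]; left.
    - exists (w :: us); rewrite !big_cons E; split=> // u.
      by rewrite inE => /orP[/eqP->|/hus//]; right.
    - exists (vs ++ us); rewrite big_cat big_cons E wE; split=> // u.
      by rewrite mem_cat => /orP[/hvs|/hus].
  exact: PA.
have WA : W `<=` A.
  move=> w Ww; rewrite -[w](big_seq1 +%R w id); apply: genA => v.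
  by rewrite inE => /eqP ->; left.
have A0 : A 0 by rewrite -[0](big_nil 0 +%R xpredT (@id G)); apply: genA.
have AD x y : A x -> A y -> A (x + y).
  move=> Ax Ay; have := genA [:: x; y]; rewrite !big_cons big_nil addr0; apply.
  by move=> v; rewrite !inE => /orP[] /eqP ->; right.
have nAx : ~ A x0.
  move=> Ax; have := PA [:: x0]; rewrite big_seq1 eqxx => /(_ _)/negP; apply=> //.
  by move=> w; rewrite inE => /eqP->; right.
exists A; split=> // y nAy.
have [ws hws sE] : exists2 ws, (forall w, w \in ws -> W w \/ (A `|` [set y]) w) &
   \sum_(w <- ws) w = x0.
  apply: contrapT => h; apply: nAy; apply: maxP => ws hws; apply/eqP => E.
  by apply: h; exists ws.
(* Copies of [y] cancel in pairs, so only the parity of their number matters. *)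
have : A (\sum_(w <- ws) w) \/ A (\sum_(w <- ws) w + y).
  elim: ws hws {sE} => [|w ws ih] hws; first by rewrite big_nil; left.
  have {ih} := ih (fun v vws => hws v (@mem_behead _ (w :: ws) v vws)); rewrite big_cons.
  have : A w \/ w = y by case: (hws w (mem_head _ _)) => [/WA|[]]; [left|left|right].
  case=> [Aw [ih|ih]|-> [ih|ih]].
  - by left; apply: AD.
  - by right; rewrite -addrA; apply: AD.
  - by right; rewrite addrC addrA exp2 add0r.
  - by left; rewrite addrC.
by rewrite sE => -[//|]; rewrite addrC.
Qed.

End MaximalSubgroup.

(** * Autocorrelation and decomposition under finitely many translations *)

Section Leaves.
Variables (R : realType) (G : topologicalZmodType).
Variable mu : {measure set (borel_type G) -> \bar R}.
Hypothesis haar : is_haar_prob mu.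
Hypothesis exp2 : forall x : G, x + x = 0.
Implicit Types g l psi : G -> R.
Local Notation I := (mean mu).

Definition autocorr g (x : G) : R := I (fun y => g y * g (y + x)).

(** For [s] equal to 1 or -1, the projection onto the [s]-eigenspace of translation by [h], an
    involution. *)
Definition half (s : R) (h : G) g : G -> R := fun y => (g y + s * g (y + h)) / 2.

(* The components of g under the translations by hs, one for each choice of signs;
   hs need not be independent, so many of them may vanish. *)
Fixpoint leaves (hs : seq G) g : seq (G -> R) :=
  if hs is h :: hs' then leaves hs' (half 1 h g) ++ leaves hs' (half (-1) h g)
  else [:: g].

(** The mean of [psi] over the translates of [x] by all subset sums of [hs], that is, over a coset
    of the subgroup spanned by [hs]. *)
Fixpoint avg (hs : seq G) psi (x : G) : R :=
  if hs is h :: hs' then (avg hs' psi x + avg hs' psi (x + h)) / 2 else psi x.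

Lemma bdmeas_half s h g : bdmeas g -> bdmeas (half s h g).
Proof.
by move=> hg; have := bdmeas_shift h hg => hg'; rewrite /half; bdmeas_tac.
Qed.

Lemma bdmeas_leaves hs g : bdmeas g -> {in leaves hs g, forall l, bdmeas l}.
Proof.
elim: hs g => [|h hs ih] g hg l /=; first by rewrite inE => /eqP ->.
by rewrite mem_cat => /orP[] /ih; apply; exact: bdmeas_half.
Qed.

(** Of the four terms of the expanded product, translation by [h] identifies two with the other
    two. *)
Lemma autocorr_half s h g x : s * s = 1 -> bdmeas g ->
  autocorr (half s h g) x = (autocorr g x + s * autocorr g (x + h)) / 2.
Proof.
move=> ss hg.
have hgs z := bdmeas_shift z hg.
have E1 : I (fun y => g (y + h) * g (y + x + h)) = autocorr g x.
  rewrite -[RHS](mean_shift haar h (bdmeasM hg (hgs x))); apply: eq_mean => y.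
  by rewrite -!addrA (addrC h).
have E2 : I (fun y => g (y + h) * g (y + x)) = autocorr g (x + h).
  rewrite -[RHS](mean_shift haar h (bdmeasM hg (hgs (x + h)))); apply: eq_mean => y.
  by rewrite -!addrA (addrC h) addKK.
have hxh := hgs (x + h).
have hxh' : bdmeas (fun y => g (y + x + h)).
  by apply: (eq_bdmeas _ hxh) => y; rewrite addrA.
rewrite (_ : _ / 2 = 4^-1 * (autocorr g x + s * autocorr g (x + h) +
   (s * autocorr g (x + h) + autocorr g x))); last by field.
rewrite -{2}E1 -{2}E2 -!(meanZ haar) -?(meanD haar) -?(meanZ haar); bdmeas_tac.
apply: eq_mean => y; rewrite /half -!addrA.
set a := g y; set b := g (y + h); set c := g (y + (x + h)); set d := g (y + x).
suff -> : (a + s * b) / 2 * ((d + s * c) / 2) =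
   4^-1 * (a * d + (s * (a * c) + (s * (b * d) + (s * s) * (b * c)))).
  by rewrite ss mul1r.
by field.
Qed.

Lemma sum_autocorr_leaves hs g x : bdmeas g ->
  \sum_(l <- leaves hs g) autocorr l x = autocorr g x.
Proof.
elim: hs g => [|h hs ih] g hg /=; first by rewrite big_seq1.
rewrite big_cat /= !ih ?autocorr_half//; try exact: bdmeas_half; last by rewrite mulr1.
- by field.
- by rewrite mulrNN mulr1.
Qed.

Lemma avgD hs psi psi' x : avg hs (fun z => psi z + psi' z) x =
  avg hs psi x + avg hs psi' x.
Proof. by elim: hs x => [|h hs ih] x //=; rewrite !ih; field. Qed.

Lemma avgZ hs c psi x : avg hs (fun z => c * psi z) x = c * avg hs psi x.
Proof. by elim: hs x => [|h hs ih] x //=; rewrite !ih; field. Qed.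

Lemma avg_cst hs c x : avg hs (fun=> c) x = c.
Proof. by elim: hs x => [|h hs ih] x //=; rewrite !ih; field. Qed.

Lemma avg_shift hs psi z x : avg hs (fun y => psi (y + z)) x = avg hs psi (x + z).
Proof. by elim: hs x => [|h hs ih] x //=; rewrite !ih addrAC. Qed.

Lemma le_avg hs psi psi' x : (forall y, psi y <= psi' y) ->
  avg hs psi x <= avg hs psi' x.
Proof.
by move=> le; elim: hs x => [|h hs ih] x //=; rewrite ler_pM2r ?invr_gt0 ?ltr0n// lerD.
Qed.

Lemma avg_inv hs psi h x : h \in hs -> avg hs psi (x + h) = avg hs psi x.
Proof.
elim: hs x => [//|k hs ih] x /=; rewrite inE => /orP[/eqP<-|hhs].
  by rewrite addKK// addrC.
by rewrite (addrAC x) !ih.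
Qed.

Lemma avg_sum hs (X : seq G) psi x :
  avg hs (fun z => \sum_(y <- X) psi (z + y)) x = \sum_(y <- X) avg hs psi (x + y).
Proof.
elim: X => [|y X ih].
  rewrite big_nil -[RHS](avg_cst hs 0 x); congr avg; apply/funext => z.
  exact: big_nil.
rewrite big_cons -ih -avg_shift -avgD; congr avg; apply/funext => z.
exact: big_cons.
Qed.

(** The average is invariant under [X], so [size X] times it is the average of the sum of the
    translates by [X], and that sum is at least [c] everywhere. *)
Lemma avg_ge hs (X : seq G) psi c x : {subset X <= hs} -> (forall z, 0 <= psi z) ->
  (forall z, exists2 y, y \in X & c <= psi (z + y)) ->
  c <= (size X)%:R * avg hs psi x.
Proof.
move=> Xhs psi0 cov.
have -> : (size X)%:R * avg hs psi x = \sum_(y <- X) avg hs psi (x + y).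
  rewrite (eq_big_seq (fun=> avg hs psi x)).
    by rewrite big_const_seq count_predT iter_addr addr0 mulr_natl.
  by move=> y /Xhs yhs; rewrite avg_inv.
rewrite -avg_sum -[leLHS](avg_cst hs c x); apply: le_avg => z.
have [y yX cy] := cov z.
by rewrite (big_rem y)//= (le_trans cy)// lerDl sumr_ge0.
Qed.

(** A form of Parseval's identity: each splitting uses ((a + b)/2)^2 + ((a - b)/2)^2 = (a^2 +
    b^2)/2. *)
Lemma sum_sqr_autocorr_leaves hs g x : bdmeas g ->
  \sum_(l <- leaves hs g) autocorr l x ^+ 2 = avg hs (fun z => autocorr g z ^+ 2) x.
Proof.
elim: hs g x => [|h hs ih] g x hg /=; first by rewrite big_seq1.
rewrite big_cat /= !ih; try exact: bdmeas_half.
rewrite -avg_shift -!avgD mulrC -avgZ; congr avg; apply/funext => z.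
rewrite !autocorr_half//; [by field|by rewrite mulrNN mulr1|by rewrite mulr1].
Qed.

Lemma leaves_eigen hs g a s : (forall y, g (y + a) = s * g y) ->
  {in leaves hs g, forall l, forall y, l (y + a) = s * l y}.
Proof.
elim: hs g => [|h hs ih] g ga l /=; first by rewrite inE => /eqP ->.
by rewrite mem_cat => /orP[] /ih; apply => y; rewrite /half addrAC !ga; field.
Qed.

(** The splitting at [h] creates an eigenfunction of translation by [h], and the later splittings
    preserve it because translations commute. *)
Lemma leaves_sign hs g h : h \in hs -> {in leaves hs g, forall l,
  (forall y, l (y + h) = l y) \/ (forall y, l (y + h) = - l y)}.
Proof.
elim: hs g => [//|k hs ih] g; rewrite inE => /orP[/eqP<-|hhs] l /=;
    rewrite mem_cat => /orP[] ll; try exact: ih ll.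
- left=> y; rewrite -[RHS]mul1r; apply: (leaves_eigen _ ll) => z.
  by rewrite /half addKK//; field.
- right=> y; rewrite -mulN1r; apply: (leaves_eigen _ ll) => z.
  by rewrite /half addKK//; field.
Qed.

Lemma autocorr0_ge0 g : 0 <= autocorr g 0.
Proof. by apply: mean_ge0 => y; rewrite addr0 -expr2 sqr_ge0. Qed.

Lemma autocorr_eigen l a s : bdmeas l ->
  (forall y, l (y + a) = s * l y) -> autocorr l a = s * autocorr l 0.
Proof.
move=> hl la; rewrite /autocorr -meanZ//.
  by apply: eq_mean => y; rewrite la addr0; ring.
by have := bdmeas_shift 0 hl => hl0; bdmeas_tac.
Qed.

(** Split [g] along [X ++ ws]. The leaf weights [autocorr l 0] sum to F, and their squares to at
    least F^2/(4N) because the translates by [X] see values at least F/2; so some leaf weighs at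
    least F/(8N). It is invariant under each [w], hence under their sum, but changes sign under [x0]
    as [g] does. *)
Lemma not_generated g (X ws : seq G) x0 : bdmeas g -> 0 < autocorr g 0 ->
  (forall y, g (y + x0) = - g y) ->
  (forall z, exists2 x, x \in X & autocorr g 0 / 2 <= autocorr g (z + x)) ->
  (forall w, w \in ws ->
    autocorr g 0 - autocorr g w < autocorr g 0 / (4 * (size X)%:R)) ->
  \sum_(w <- ws) w != x0.
Proof.
move=> hg F0 gx0 cov hws; apply/eqP => sE.
set F := autocorr g 0 in F0 cov hws.
have N0 : 0 < (size X)%:R :> R.
  rewrite ltr0n; have [x + _] := cov 0; by case: (X).
set N : R := (size X)%:R in N0 hws.
pose hs := X ++ ws.
have sq : F ^+ 2 / (4 * N) <= \sum_(l <- leaves hs g) autocorr l 0 ^+ 2.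
  rewrite sum_sqr_autocorr_leaves//.
  have : (F / 2) ^+ 2 <= N * avg hs (fun z => autocorr g z ^+ 2) 0.
    apply: avg_ge; [by move=> x xX; rewrite mem_cat xX|by move=> z; exact: sqr_ge0|].
    move=> z; have [x xX hx] := cov z; exists x => //.
    by rewrite ler_sqr ?nnegrE ?(le_trans _ hx)// divr_ge0// ltW.
  move=> h; rewrite ler_pdivrMr ?mulr_gt0//; lra.
have sF : \sum_(l <- leaves hs g) autocorr l 0 = F by exact: sum_autocorr_leaves.
have [l lin lbig] : exists2 l, l \in leaves hs g & F / (8 * N) <= autocorr l 0.
  apply: contrapT => h.
  have : \sum_(l <- leaves hs g) autocorr l 0 ^+ 2 <= F / (8 * N) * F.
    rewrite -{2}sF mulr_sumr big_seq [leRHS]big_seq; apply: ler_sum => l lin.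
    rewrite expr2 ler_wpM2r ?autocorr0_ge0// leNgt; apply/negP => /ltW h'.
    by apply: h; exists l.
  move=> /(le_trans sq); rewrite leNgt => /negP; apply.
  rewrite mulrAC -expr2 ltr_pM2l ?exprn_gt0// ltf_pV2 ?posrE ?mulr_gt0//.
  by rewrite ltr_pM2r// ltr_nat.
have lm k : k \in leaves hs g -> bdmeas k by move=> kin; exact: (bdmeas_leaves hg kin).
have linv w : w \in ws -> forall y, l (y + w) = l y.
  move=> wws; have whs : w \in hs by rewrite mem_cat wws orbT.
  case: (leaves_sign whs lin) => // lN.
  have le2 k : k \in leaves hs g -> autocorr k w <= autocorr k 0.
    move=> kin; case: (leaves_sign whs kin) => kw.
      by rewrite (@autocorr_eigen _ _ 1 (lm _ kin)) ?mul1r// => y; rewrite mul1r.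
    rewrite (@autocorr_eigen _ _ (-1) (lm _ kin)) ?mulN1r//; last by move=> y; rewrite mulN1r.
    by have := autocorr0_ge0 k; lra.
  (* No leaf contributes negatively to the deficit at [w], and a leaf changing sign contributes
     twice its weight. *)
  have : 2 * autocorr l 0 <= F - autocorr g w.
    rewrite -sF -(sum_autocorr_leaves hs w hg) -sumrB (big_rem l)//=.
    rewrite (@autocorr_eigen l w (-1) (lm _ lin)); last by move=> y; rewrite mulN1r.
    rewrite -[leLHS]addr0 lerD//; first by lra.
    rewrite big_seq sumr_ge0// => k /mem_rem /le2; lra.
  have := hws _ wws; have -> : F / (4 * N) = 2 * (F / (8 * N)).
    by field; rewrite gt_eqF.
  lra.
have : forall y, l (y + \sum_(w <- ws) w) = l y.
  elim: (ws) linv => [|w vs ih] linv y; first by rewrite big_nil addr0.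
  rewrite big_cons addrA ih ?linv ?mem_head// => v vvs z.
  by apply: linv; rewrite inE vvs orbT.
rewrite sE => lx.
have lx' : forall y, l (y + x0) = -1 * l y.
  by apply: (leaves_eigen _ lin) => y; rewrite gx0 mulN1r.
have : autocorr l 0 = 0.
  rewrite /autocorr -[RHS](mean_cst haar 0); apply: eq_mean => y.
  by have := lx y; rewrite lx' => h; rewrite (_ : l y = 0) ?mul0r//; lra.
have : 0 < F / (8 * N) by rewrite divr_gt0 ?mulr_gt0.
lra.
Qed.

End Leaves.

(** * Characters separate points *)

Section Separation.
Variables (R : realType) (G : topologicalZmodType).
Variable mu : {measure set (borel_type G) -> \bar R}.
Hypothesis haar : is_haar_prob mu.
Hypothesis haus : hausdorff_space G.
Hypothesis cpt : compact [set: G].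
Hypothesis exp2 : forall x : G, x + x = 0.
Local Notation I := (mean mu).
Local Notation ind A := (\1_(A : set G) : G -> R).

Lemma finite_translates (W : set G) : nbhs (0 : G) W ->
  exists X : seq G, forall z, exists2 x, x \in X & W (z + x).
Proof.
move=> W0; have : @cover_compact G setT by rewrite -[@cover_compact G](@compact_cover (ptd G)).
move=> /(_ G setT (fun x z => W^° (z + x)%R)); case.
- move=> x _; have := @open_comp _ _ (fun z : G => z + x) W^°.
  by apply; [move=> z _; exact: shift_continuous|exact: open_interior].
- by move=> z _; exists (- z) => //=; rewrite subrr.
move=> X _ hX; exists (finmap.enum_fset X) => z; have [x xX Wx] := hX z Logic.I.
by exists x => //; exact: interior_subset.
Qed.

Lemma shift_nbhs (W : set G) (x : G) : nbhs (0 : G) W -> nbhs x [set y | W (y + x)].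
Proof.
move=> W0; have := @shift_continuous G x x; rewrite /continuous_at exp2; exact.
Qed.

(** By compactness finitely many translates of [U] cover the group, and all have the same mean. *)
Lemma mean_open_gt0 (U : set G) : open U -> U 0 -> 0 < I (ind U).
Proof.
move=> oU U0; have hU : bdmeas (ind U) by apply: bdmeas_indic; exact: open_borel.
have [X hX] := finite_translates (open_nbhs_nbhs (conj oU U0)).
have : 1 <= (size X)%:R * I (ind U).
  have -> : (size X)%:R * I (ind U) = \sum_(x <- X) I (fun y => ind U (y + x)).
    rewrite (eq_bigr (fun=> I (ind U))); last by move=> x _; exact: mean_shift.
    by rewrite big_const_seq count_predT iter_addr addr0 mulr_natl.
  rewrite -(mean_sum haar); last by move=> x _; exact: bdmeas_shift.
  rewrite -[leLHS](mean_cst haar); apply: le_mean => //.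
  - exact: bdmeas_cst.
  - by apply: bdmeas_sum => x _; exact: bdmeas_shift.
  - move=> z; have [x xX Ux] := hX z; rewrite (big_rem x)//=.
    rewrite [X in X + _]indicE mem_set// lerDl sumr_ge0//.
have : 0 <= I (ind U) by apply: mean_ge0 => y; rewrite indicE ler0n.
rewrite le_eqVlt => /predU1P[<-|//]; rewrite mulr0; lra.
Qed.

Lemma compact_borel (K : set G) : compact K -> measurable (K : set (borel_type G)).
Proof. by move=> cK; exact: (closed_borel (compact_closed haus cK)). Qed.

Lemma fin_mu (A : set (borel_type G)) : measurable A -> mu A \is a fin_num.
Proof.
move=> mA; rewrite ge0_fin_numE// (@le_lt_trans _ _ (mu setT))//.
  by rewrite le_measure// inE.
by have [-> _ _ _] := haar; rewrite ltry.
Qed.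

Lemma compact_inner (U : set G) (e : R) : open U -> 0 < e ->
  exists K, [/\ compact K, K `<=` U & I (ind U) < I (ind K) + e].
Proof.
move=> oU e0; have mU := open_borel oU.
have [_ _ _ /(_ U oU) supU] := haar.
have : (mu U - e%:E < mu U)%E by rewrite lteBlDr ?fin_mu// lteDl ?fin_mu.
rewrite {2}supU => /ereal_sup_gt[_ [K [cK KU] <-]] lt.
exists K; split=> //; rewrite !mean_indic//; last exact: compact_borel.
move: lt; rewrite -(fineK (fin_mu mU)) -(fineK (fin_mu (compact_borel cK))).
by rewrite -EFinB lte_fin ltrBlDr.
Qed.

Lemma open_outer (A : set (borel_type G)) (e : R) : measurable A -> 0 < e ->
  exists U : set G, [/\ open U, (A : set G) `<=` U & I (ind U) < I (ind A) + e].
Proof.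
move=> mA e0; have [_ _ /(_ A mA) infA _] := haar.
have : (mu A < mu A + e%:E)%E by rewrite lteDl ?fin_mu.
rewrite {1}infA => /ereal_inf_lt[_ [U [oU AU] <-]] lt.
have mU := open_borel oU.
exists U; split=> //; rewrite !mean_indic//.
move: lt; rewrite -(fineK (fin_mu mU)) -(fineK (fin_mu mA)).
by rewrite -EFinD lte_fin.
Qed.

Lemma compact_shift_near (K U : set G) : compact K -> open U -> K `<=` U ->
  \forall w \near (0 : G), forall x, K x -> U (x + w).
Proof.
move=> /compact_near_coveringP cK oU KU.
apply: (cK _ (nbhs (0 : G)) (fun w x => U (x + w))) => x Kx.
have : nbhs (x + 0) U by rewrite addr0; apply: open_nbhs_nbhs; split=> //; exact: KU.
move=> /(@add_continuous G (x, 0)) [[A B] /= [Ax B0] AB].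
by exists (A, B).
Qed.

(** The deficit at [w] is half the squared L2 distance from [g] to its translate. If [K] is compact
    in [U] and [K + w] stays in [U], four translates of 1_U - 1_K dominate the integrand, whence the
    tolerance [e / 4]. *)
Lemma autocorr_near (U : set G) x0 (g := fun y => ind U y - ind U (y + x0)) e :
  open U -> 0 < e ->
  \forall w \near (0 : G), autocorr mu g 0 - autocorr mu g w < e.
Proof.
move=> oU e0.
have hU : bdmeas (ind U) by apply: bdmeas_indic; exact: open_borel.
have [|K [cK KU IK]] := @compact_inner U (e / 4) oU; first by lra.
have hK : bdmeas (ind K) by apply: bdmeas_indic; exact: compact_borel.
have hg : bdmeas g by apply: bdmeasB => //; exact: bdmeas_shift.
apply: filterS (compact_shift_near cK oU KU) => w Kw.
have hgw := bdmeas_shift w hg; have hg0 := bdmeas_shift 0 hg.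
pose D y := ind U y - ind K y.
have hD : bdmeas D by apply: bdmeasB.
have hDs z := bdmeas_shift z hD.
have key : autocorr mu g 0 - autocorr mu g w <=
   I (fun y => D y + D (y + w) + (D (y + x0) + D (y + (w + x0)))).
  have -> : autocorr mu g 0 - autocorr mu g w =
      I (fun y => 2^-1 * (g y - g (y + w)) ^+ 2).
    have E : autocorr mu g 0 = I (fun y => g (y + w) * g (y + w)).
      rewrite -[LHS](mean_shift haar w (bdmeasM hg hg0)).
      by apply: eq_mean => y; rewrite addr0.
    rewrite (_ : _ - _ = 2^-1 * (autocorr mu g 0 + autocorr mu g 0 -
       2 * autocorr mu g w)); last by field.
    rewrite {2}E -(meanZ haar) -?(meanD haar) -?(meanB haar) -?(meanZ haar); bdmeas_tac.
    by apply: eq_mean => y; rewrite addr0; ring.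
  apply: le_mean => //; bdmeas_tac.
  have DU y : (ind U y - ind U (y + w)) ^+ 2 <= D y + D (y + w).
    rewrite /D !indicE.
    have UU : y + w + w = y by exact: addKK.
    have h1 : (y \in K) ==> (y \in U) by apply/implyP; rewrite !inE => /KU.
    have h2 : (y \in K) ==> (y + w \in U) by apply/implyP; rewrite !inE => /Kw.
    have h3 : (y + w \in K) ==> (y + w \in U) by apply/implyP; rewrite !inE => /KU.
    have h4 : (y + w \in K) ==> (y \in U).
      by apply/implyP; rewrite !inE => /Kw; rewrite UU.
    move: h1 h2 h3 h4; do 4 case: (_ \in _) => //=; lra.
  move=> y; apply: (@le_trans _ _ ((ind U y - ind U (y + w)) ^+ 2 +
     (ind U (y + x0) - ind U (y + x0 + w)) ^+ 2)).
    rewrite /g (addrAC y w).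
    set a := ind U y; set b := ind U (y + x0); set c := ind U (y + w).
    set d := ind U (y + x0 + w).
    have := sqr_ge0 ((a - c) + (b - d)); lra.
  by rewrite (_ : y + (w + x0) = y + x0 + w) ?lerD// addrA addrAC.
apply: (le_lt_trans key).
have ID : I D = I (ind U) - I (ind K) by exact: meanB.
have IDs z : I (fun y => D (y + z)) = I D by exact: mean_shift.
clearbody D; rewrite !(meanD haar); bdmeas_tac.
rewrite !IDs ID; lra.
Qed.

(** [A] has index two, so its sign function is multiplicative; it is locally constant because [A]
    contains a neighbourhood of 0. *)
Lemma character_sign (A : set G) (W : set G) x0 : nbhs (0 : G) W -> W `<=` A ->
  (forall x y, A x -> A y -> A (x + y)) -> ~ A x0 ->
  (forall y, ~ A y -> A (y + x0)) ->
  character (fun y => if `[< A y >] then 1 else -1 : R).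
Proof.
move=> W0 WA AD nA Ax.
set chi := fun y => _.
have chiM x y : chi (x + y) = chi x * chi y.
  rewrite /chi; case: asboolP => Axy; case: asboolP => Ax'; case: asboolP => Ay;
    rewrite ?mulr1 ?mul1r ?mulrNN ?mulr1//.
  - by case: Ay; have := AD _ _ Ax' Axy; rewrite addrA exp2 add0r.
  - by case: Ax'; have := AD _ _ Axy Ay; rewrite addKK.
  - by case: Axy; apply: AD.
  - case: Axy; have := AD _ _ (Ax _ Ax') (Ax _ Ay).
    by rewrite addrACA exp2 addr0.
split=> //; last by move=> x; rewrite /chi; case: ifP; rewrite ?normrN normr1.
move=> x; apply: cvg_near_cst.
apply: filterS (shift_nbhs x W0) => y /WA Ayx.
have : chi (y + x) = 1 by rewrite /chi; case: asboolP.
rewrite chiM /chi; case: ifP => _; case: ifP => _ //; rewrite ?mulr1 ?mul1r//; lra.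
Qed.

Lemma character_separates (x0 : G) : x0 != 0 ->
  exists2 chi : G -> R, character chi & chi x0 = -1.
Proof.
move=> x0N.
have [U [oU U0 Udisj]] : exists U : set G, [/\ open U, U 0 &
    forall y, U y -> ~ U (y + x0)].
  move: haus; rewrite open_hausdorff => /(_ 0 x0); rewrite eq_sym => /(_ x0N).
  case=> -[A B] /= [+ +] [oA oB AB]; rewrite !inE => A0 Bx.
  exists (A `&` [set y | B (y + x0)]); split.
  - apply: openI => //; have := @open_comp _ _ (fun z : G => z + x0) B.
    by apply=> // z _; exact: shift_continuous.
  - by split=> //=; rewrite add0r.
  - move=> y [_ By] [Ay _]; have : (A `&` B) (y + x0) by [].
    by rewrite (eqP AB).
pose g := fun y => ind U y - ind U (y + x0).
have hU : bdmeas (ind U) by apply: bdmeas_indic; exact: open_borel.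
have hg : bdmeas g by apply: bdmeasB => //; exact: bdmeas_shift.
(* On [U] the translated indicator vanishes, so the square of [g] dominates 1_U. *)
have F0 : 0 < autocorr mu g 0.
  apply: (lt_le_trans (mean_open_gt0 oU U0)); apply: le_mean => //.
    by apply: bdmeasM => //; exact: bdmeas_shift.
  move=> y; rewrite addr0 -expr2 /g.
  have [Uy|nUy] := pselect (U y); last by rewrite [leLHS]indicE memNset// sqr_ge0.
  by rewrite !indicE (mem_set Uy) memNset ?subr0 ?expr1n//; exact: Udisj.
set F := autocorr mu g 0 in F0.
(* The two tolerances F/2 and F/(4N) are those required by [not_generated]; N is fixed by the first,
   before the second is chosen. *)
have [|X hX] := finite_translates (@autocorr_near U x0 (F / 2) oU _).
  by rewrite divr_gt0.
have N0 : 0 < (size X)%:R :> R.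
  by rewrite ltr0n; have [x + _] := hX 0; case: (X).
have F4 : 0 < F / (4 * (size X)%:R) by rewrite divr_gt0 ?mulr_gt0.
have Wn := @autocorr_near U x0 _ oU F4.
have [|A [WA A0 AD nAx Ax]] := @index_two_subgroup G exp2
    [set w | F - autocorr mu g w < F / (4 * (size X)%:R)] x0; last first.
  exists (fun y => if `[< A y >] then 1 else -1); first exact: (character_sign Wn WA AD nAx Ax).
  by case: asboolP.
move=> ws hws; apply: (@not_generated _ _ mu haar exp2 g X) => //.
- by move=> y; rewrite /g addKK// opprB.
- by move=> z; have [x xX hx] := hX z; exists x => //; move: hx; rewrite -/F; lra.
Qed.

End Separation.

(** * Finite subgroups of the dual *)

Section DualGroups.
Variables (R : realType) (G : topologicalZmodType).
Implicit Types (g u v : G -> R) (V : seq (G -> R)).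

Definition cmul u v : G -> R := fun x => u x * v x.

(** A duplicate-free list makes [size V] the order of the subgroup; inverses are automatic since
    characters square to 1. *)
Definition dual_group V := [/\ uniq V, (forall v, v \in V -> character v),
  (fun=> 1) \in V & forall u v, u \in V -> v \in V -> cmul u v \in V].

Lemma cmulC u v : cmul u v = cmul v u.
Proof. by apply/funext => x; exact: mulrC. Qed.

Lemma cmulA u v w : cmul u (cmul v w) = cmul (cmul u v) w.
Proof. by apply/funext => x; exact: mulrA. Qed.

Lemma character_sqr g x : character g -> g x * g x = 1.
Proof. by case=> _ _ /(_ x) gx; rewrite -expr2 -real_normK ?num_real// gx expr1n. Qed.

Lemma character_pm g x : character g -> g x = 1 \/ g x = -1.
Proof.
move=> /(character_sqr x)/eqP; rewrite -expr2 sqrf_eq1 => /orP[]/eqP ->; by [left|right].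
Qed.

Lemma cmulK u v : character v -> cmul (cmul u v) v = u.
Proof.
by move=> hv; apply/funext => x; rewrite /cmul -mulrA character_sqr// mulr1.
Qed.

Lemma character1 : character (fun _ : G => 1 : R).
Proof. by split=> [x|x y|x]; [exact: cvg_cst|rewrite mulr1|rewrite normr1]. Qed.

Lemma characterM u v : character u -> character v -> character (cmul u v).
Proof.
move=> [cu mu nu] [cv mv nv]; split.
- by move=> x; apply: cvgM; [exact: cu|exact: cv].
- by move=> x y; rewrite /cmul mu mv mulrACA.
- by move=> x; rewrite normrM nu nv mulr1.
Qed.

Lemma bdmeas_character g : character g -> bdmeas g.
Proof.
move=> [cg _ ng]; split; first exact: continuous_measurable_borel.
by exists 1 => x; rewrite ng.
Qed.

Lemma dual_group1 : dual_group [:: (fun=> 1)].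
Proof.
split=> [//|v||u v]; [by rewrite mem_seq1 => /eqP ->; exact: character1|exact: mem_head|].
rewrite !mem_seq1 => /eqP -> /eqP ->; apply/eqP/funext => x.
by rewrite /cmul mulr1.
Qed.

Definition adjoin V g := V ++ [seq cmul v g | v <- V].

Lemma mem_adjoin V g u : character g ->
  (u \in adjoin V g) = (u \in V) || (cmul u g \in V).
Proof.
move=> hg; rewrite mem_cat; congr orb; apply/mapP/idP => [[v vV ->]|ugV].
  by rewrite cmulK.
by exists (cmul u g) => //; rewrite cmulK.
Qed.

Lemma size_adjoin V g : size (adjoin V g) = (2 * size V)%N.
Proof. by rewrite size_cat size_map addnn mul2n. Qed.

Lemma dual_group_adjoin V g : dual_group V -> character g -> g \notin V ->
  dual_group (adjoin V g).
Proof.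
move=> [uV cV V1 VM] hg gV; split.
- rewrite cat_uniq uV map_inj_in_uniq ?uV ?andbT; last first.
    by move=> u v _ _ /(congr1 (cmul^~ g)); rewrite !cmulK.
  apply/hasPn => _ /mapP[v vV ->]; apply: contra gV => vgV.
  have := VM _ _ vgV vV; rewrite cmulC cmulA (_ : cmul v v = fun=> 1).
    by rewrite (_ : cmul _ g = g)//; apply/funext => x; rewrite /cmul mul1r.
  by apply/funext => x; rewrite /cmul character_sqr//; exact: cV.
- move=> v; rewrite mem_adjoin// => /orP[/cV//|/cV vg].
  by rewrite -(cmulK v hg); apply: characterM.
- by rewrite mem_cat V1.
- move=> u v; rewrite !mem_adjoin// => /orP[] uV' /orP[] vV'.
  + by rewrite VM.
  + by rewrite -cmulA (VM _ _ uV' vV') orbT.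
  + by rewrite -cmulA (cmulC v) cmulA (VM _ _ uV' vV') orbT.
  + have := VM _ _ uV' vV'; rewrite cmulA -(cmulA u) (cmulC g) cmulA cmulK// => ->.
    by [].
Qed.

Lemma sub_adjoin V g : {subset V <= adjoin V g}.
Proof. by move=> v vV; rewrite mem_cat vV. Qed.

Lemma adjoin_self V g : dual_group V -> character g -> g \in adjoin V g.
Proof.
move=> [_ _ V1 _] hg; rewrite mem_adjoin//; apply/orP; right.
by rewrite (_ : cmul g g = fun=> 1)//; apply/funext => x; exact: character_sqr.
Qed.

Lemma dual_group_span V (l : seq (G -> R)) : dual_group V ->
  (forall g, g \in l -> character g) ->
  exists V', [/\ dual_group V', {subset V <= V'} & {subset l <= V'}].
Proof.
move=> hV; elim: l => [|g l ih] hl; first by exists V; split.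
have [|V' [hV' VV' lV']] := ih; first by move=> u ul; apply: hl; rewrite in_cons ul orbT.
have hg := hl g (mem_head _ _).
have [gV'|gV'] := boolP (g \in V').
  by exists V'; split=> // u; rewrite in_cons => /orP[/eqP ->//|/lV'].
exists (adjoin V' g); split; first exact: dual_group_adjoin.
- by move=> v /VV'; exact: sub_adjoin.
- move=> u; rewrite in_cons => /orP[/eqP ->|/lV']; [exact: adjoin_self|exact: sub_adjoin].
Qed.

Lemma big_translate V u (F : (G -> R) -> R) : dual_group V -> u \in V ->
  \sum_(v <- V) F (cmul u v) = \sum_(v <- V) F v.
Proof.
move=> [uV cV V1 VM] uV'; rewrite -(big_map (cmul u) xpredT F); apply: perm_big.
apply: uniq_perm => //.
  rewrite map_inj_in_uniq// => a b _ _ /(congr1 (cmul^~ u)).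
  by rewrite (cmulC u a) (cmulC u b) !cmulK//; exact: cV.
move=> v; apply/mapP/idP => [[w wV ->]|vV]; first exact: VM.
by exists (cmul u v); [exact: VM|rewrite cmulC (cmulC u) cmulK//; exact: cV].
Qed.

(** If some [u] in [V] has [u z = -1], reindexing the sum by multiplication with [u] negates it. *)
Lemma sum_dual_group V z : dual_group V ->
  \sum_(v <- V) v z = if all (fun v => v z == 1) V then (size V)%:R else 0.
Proof.
move=> hV; case: ifPn => [/allP hz|/allPn[u uV uz]].
  rewrite (eq_big_seq (fun=> 1)); last by move=> v /hz /eqP.
  by rewrite big_const_seq count_predT iter_addr addr0.
have [_ cV _ _] := hV.
have uz' : u z = -1 by case: (character_pm z (cV _ uV)) => // E; rewrite E eqxx in uz.
have := big_translate (fun v => v z) hV uV; rewrite /cmul -mulr_sumr uz'; lra.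
Qed.

(** The sign pattern labels the coset of the annihilator of [V] containing [x], with labels in a
    finite type. *)
Definition pat V (x : G) : {ffun seq_sub V -> bool} := [ffun v => val v x == 1].

(** By orthogonality ([cosetE]), the indicator in [y] of the coset of the annihilator of [V] through
    [x]. *)
Definition coset V (x y : G) : R := (size V)%:R^-1 * \sum_(v <- V) v x * v y.

(* Junk value 0 when no point has pattern p. *)
Definition rep V (p : {ffun seq_sub V -> bool}) : G := xget 0 [set x | pat V x = p].

Lemma rep_pat V x : pat V (rep (pat V x)) = pat V x.
Proof. exact: (@xgetPex _ 0 [set y | pat V y = pat V x] (ex_intro _ x erefl)). Qed.

Lemma pat_eqP V x y : dual_group V ->
  reflect (forall v, v \in V -> v (x + y) = 1) (pat V x == pat V y).
Proof.
move=> [_ cV _ _]; apply: (iffP eqP) => [/ffunP E v vV|h].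
  have := E (SeqSub vV); rewrite !ffunE /= => Ev; have [_ -> _] := cV _ vV.
  have n11 : (-1 == 1 :> R) = false by rewrite lt_eqF//; lra.
  have [vx|vx] := character_pm x (cV _ vV); have [vy|vy] := character_pm y (cV _ vV);
    move: Ev; rewrite vx vy ?eqxx ?n11// => _; lra.
apply/ffunP => -[v vV]; rewrite !ffunE /=; have := h v vV.
have [_ -> _] := cV _ vV.
have [vx|vx] := character_pm x (cV _ vV); have [vy|vy] := character_pm y (cV _ vV);
    rewrite vx vy //; lra.
Qed.

Lemma dual_group_size V : dual_group V -> (0 < size V)%N.
Proof. by case=> _ _ + _; case: V. Qed.

Lemma cosetE V x y : dual_group V -> coset V x y = (pat V x == pat V y)%:R.
Proof.
move=> hV; have s0 := dual_group_size hV; have [_ cV _ _] := hV.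
rewrite /coset (eq_big_seq (fun v => v (x + y))); last first.
  by move=> v /cV[_ -> _].
rewrite sum_dual_group//.
have -> : all (fun v => v (x + y) == 1) V = (pat V x == pat V y).
  by apply/allP/(pat_eqP _ _ hV) => h v vV; [apply/eqP|]; rewrite h.
by case: (_ == _); rewrite ?mulr0// mulVf// pnatr_eq0 -lt0n.
Qed.

(** For realised patterns [rep] is a genuine representative, so only the coset with the pattern of
    [y] contributes. *)
Lemma sum_coset V (Q : pred {ffun seq_sub V -> bool}) y : dual_group V ->
  (forall p, Q p -> exists x, pat V x = p) ->
  \sum_(p | Q p) coset V (rep p) y = (Q (pat V y))%:R.
Proof.
move=> hV hQ.
have E p : Q p -> coset V (rep p) y = (p == pat V y)%:R.
  by move=> /hQ[x <-]; rewrite cosetE// rep_pat.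
rewrite (eq_bigr _ E).
have [Qy|nQy] := boolP (Q (pat V y)).
  by rewrite (bigD1 (pat V y))//= eqxx big1 ?addr0// => p /andP[_ /negbTE ->].
rewrite big1// => p Qp; case: eqP => // E'; by rewrite -E' Qp in nQy.
Qed.

End DualGroups.

(** * Fourier coefficients and projections *)

Section Fourier.
Variables (R : realType) (G : topologicalZmodType).
Variable mu : {measure set (borel_type G) -> \bar R}.
Hypothesis haar : is_haar_prob mu.
Implicit Types (f g h u v : G -> R) (V : seq (G -> R)).
Local Notation I := (mean mu).
Local Notation ind A := (\1_(A : set G) : G -> R).

Definition fcoef f g : R := I (fun x => f x * g x).

Definition fproj V f : G -> R := fun x => \sum_(v <- V) fcoef f v * v x.

(** Translating by a point where [g] is -1 negates the mean. *)
Lemma mean_character g : character g -> g <> (fun=> 1) -> I g = 0.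
Proof.
move=> hg g1; have [x gx] : exists x, g x <> 1.
  by apply: contrapT => h; apply: g1; apply/funext => x; apply: contrapT => h'; apply: h; exists x.
have hm := bdmeas_character hg.
have := mean_shift haar x hm.
have -> : (fun y => g (y + x)) = (fun y => g x * g y).
  by apply/funext => y; have [_ -> _] := hg; rewrite mulrC.
rewrite meanZ//; have [//|->] := character_pm x hg; lra.
Qed.

Lemma fcoef_character u v : character u -> character v -> fcoef u v = (u == v)%:R.
Proof.
move=> hu hv; case: eqP => [->|uv].
  by rewrite -[RHS](mean_cst haar); apply: eq_mean => x; exact: character_sqr.
apply: (@mean_character (cmul u v)); first exact: characterM.
move=> E; apply: uv; rewrite -(cmulK u hv) E; apply/funext => x.
by rewrite /cmul mul1r.
Qed.

Lemma bdmeas_dual V v : dual_group V -> v \in V -> bdmeas v.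
Proof. by move=> [_ cV _ _] /cV; exact: bdmeas_character. Qed.

Lemma bdmeas_comb V (c : (G -> R) -> R) : dual_group V ->
  bdmeas (fun x => \sum_(v <- V) c v * v x).
Proof.
move=> hV; apply: (@eq_bdmeas _ _ _ (fun x => \sum_(v <- V | v \in V) c v * v x)).
  by move=> x; rewrite -big_seq.
apply: bdmeas_sum => v vV; have hv := bdmeas_dual hV vV; bdmeas_tac.
Qed.

Lemma fcoef_comb V (c : (G -> R) -> R) h : dual_group V -> bdmeas h ->
  fcoef (fun x => \sum_(v <- V) c v * v x) h = \sum_(v <- V) c v * fcoef v h.
Proof.
move=> hV hh.
rewrite [RHS]big_seq (eq_bigr (fun v => I (fun x => c v * (v x * h x)))); last first.
  by move=> v vV; have hv := bdmeas_dual hV vV; rewrite meanZ//; bdmeas_tac.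
rewrite -(mean_sum haar); last first.
  by move=> v vV; have hv := bdmeas_dual hV vV; bdmeas_tac.
apply: eq_mean => x; rewrite -big_seq mulr_suml; apply: eq_bigr => v _.
by rewrite mulrA.
Qed.

Lemma fcoefC f g : fcoef f g = fcoef g f.
Proof. by apply: eq_mean => x; rewrite mulrC. Qed.

Lemma fcoefBl f g h : bdmeas f -> bdmeas g -> bdmeas h ->
  fcoef (fun x => f x - g x) h = fcoef f h - fcoef g h.
Proof.
move=> hf hg hh; rewrite /fcoef -meanB//; bdmeas_tac.
by apply: eq_mean => x; rewrite mulrBl.
Qed.

Lemma fcoef_proj V f v : dual_group V -> v \in V -> fcoef (fproj V f) v = fcoef f v.
Proof.
move=> hV vV; have [uV cV _ _] := hV; rewrite fcoef_comb//; last exact: (bdmeas_dual hV).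
rewrite (bigD1_seq v)//= (fcoef_character (cV _ vV) (cV _ vV)) eqxx mulr1.
rewrite big1_seq ?addr0// => w /andP[wv wV].
by rewrite (fcoef_character (cV _ wV) (cV _ vV)) (negbTE wv) mulr0.
Qed.

(** Pythagoras: [f - fproj mu V f] is orthogonal to every combination of [V]. *)
Lemma proj_best V f (c : (G -> R) -> R) : dual_group V -> bdmeas f ->
  I (fun x => (f x - fproj V f x) ^+ 2) <=
  I (fun x => (f x - \sum_(v <- V) c v * v x) ^+ 2).
Proof.
move=> hV hf; set q := fun x => \sum_(v <- V) c v * v x.
have hq : bdmeas q by exact: bdmeas_comb.
have hp : bdmeas (fproj V f) by exact: bdmeas_comb.
set p := fproj V f in hp *.
have hr : bdmeas (fun x => f x - p x) by bdmeas_tac.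
have hd : bdmeas (fun x => p x - q x) by bdmeas_tac.
have orth : fcoef (fun x => p x - q x) (fun x => f x - p x) = 0.
  have -> : (fun x => p x - q x) = (fun x => \sum_(v <- V) (fcoef f v - c v) * v x).
    apply/funext => x; rewrite /p /q /fproj -sumrB; apply: eq_bigr => v _.
    by rewrite mulrBl.
  rewrite fcoef_comb// big1_seq// => v /andP[_ vV].
  have hv := bdmeas_dual hV vV.
  by rewrite (fcoefC v) fcoefBl// /p fcoef_proj// subrr mulr0.
have -> : I (fun x => (f x - q x) ^+ 2) =
   I (fun x => (f x - p x) ^+ 2) + I (fun x => (p x - q x) ^+ 2) +
     2 * fcoef (fun x => p x - q x) (fun x => f x - p x).
  rewrite /fcoef -(meanZ haar) -?(meanD haar); bdmeas_tac.
  by apply: eq_mean => x; ring.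
rewrite orth mulr0 addr0 lerDl; apply: mean_ge0 => x; exact: sqr_ge0.
Qed.

Lemma bdmeas_coset V x : dual_group V -> bdmeas (coset V x).
Proof. by move=> hV; have := bdmeas_comb (fun v => v x) hV => h; rewrite /coset; bdmeas_tac. Qed.

Lemma mean_coset V x : dual_group V -> I (coset V x) = (size V)%:R^-1.
Proof.
move=> hV; have hb := bdmeas_comb (fun v => v x) hV; have [_ cV V1 _] := hV.
rewrite /coset meanZ// -[RHS]mulr1; congr (_ * _).
have E := fcoef_comb (fun v => v x) hV (@bdmeas_cst R G 1).
rewrite -[LHS](_ : fcoef (fun y => \sum_(v <- V) v x * v y) (fun=> 1) = _); last first.
  by apply: eq_mean => y; rewrite mulr1.
rewrite E; have [uV _ _ _] := hV.
have c1 := @character1 R G.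
rewrite (bigD1_seq (fun=> 1))//= (fcoef_character c1 c1) eqxx mulr1.
rewrite big1_seq ?addr0// => v /andP[v1 vV].
by rewrite (fcoef_character (cV _ vV) c1) (negbTE v1) mulr0.
Qed.

(** Projecting to [V] is averaging over a coset of its annihilator, a set of measure 1/|V|. *)
Lemma projE V f y : dual_group V -> bdmeas f ->
  fproj V f y = (size V)%:R * fcoef f (coset V y).
Proof.
move=> hV hf; have hb := bdmeas_comb (fun v => v y) hV.
have s0 : (size V)%:R != 0 :> R by rewrite pnatr_eq0 -lt0n dual_group_size.
rewrite /coset fcoefC /fcoef.
under [X in I X]funext do rewrite -mulrA.
rewrite meanZ//; last by bdmeas_tac.
rewrite mulrA mulfV// mul1r -/(fcoef (fun x => \sum_(v <- V) v y * v x) f) fcoef_comb//.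
by apply: eq_bigr => v _; rewrite fcoefC mulrC.
Qed.

End Fourier.

(** * Approximation in L2 by finite Fourier expansions *)

Section Approximation.
Variables (R : realType) (G : topologicalZmodType).
Variable mu : {measure set (borel_type G) -> \bar R}.
Hypothesis haar : is_haar_prob mu.
Hypothesis haus : hausdorff_space G.
Hypothesis cpt : compact [set: G].
Hypothesis exp2 : forall x : G, x + x = 0.
Implicit Types (f g h u v : G -> R) (V : seq (G -> R)).
Local Notation I := (mean mu).
Local Notation ind A := (\1_(A : set G) : G -> R).

(** Every point off the interior of [O] has a character negative there; by compactness finitely many
    suffice, and these are adjoined to [V]. *)
Lemma annihilator_near V (O : set G) : dual_group V -> nbhs (0 : G) O ->
  exists V', [/\ dual_group V', {subset V <= V'} &
    forall z, (forall v, v \in V' -> v z = 1) -> O z].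
Proof.
move=> hV O0.
have cK : compact (~` O^°).
  apply: (subclosed_compact _ cpt) => //; exact/open_closedC/open_interior.
have : @cover_compact G (~` O^°) by rewrite -[@cover_compact G](@compact_cover (ptd G)).
move=> /(_ (G -> R) [set g | character g] (fun g z => g z < 0)); case.
- move=> g [cg _ _]; have := @open_comp _ _ g [set r : R | r < 0].
  by apply; [move=> z _; exact: cg|exact: open_lt].
- move=> z nz; have z0 : z != 0.
    by apply: contra_notN nz => /eqP ->; exact: nbhs_singleton (nbhs_interior O0).
  have [chi hchi chiz] := character_separates haar haus cpt exp2 z0.
  by exists chi => //=; rewrite chiz; lra.
move=> X hX cov; have [|V' [hV' VV' XV']] := @dual_group_span R G V (finmap.enum_fset X) hV.
  by move=> g /hX; rewrite inE.
exists V'; split=> // z hz; apply: contrapT => nOz.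
have [|g gX gz] := cov z; first by move=> /interior_subset.
by have := hz g (XV' _ gX); lra.
Qed.

(** Regularity gives [U] containing [A] and a compact [K] in [U], each within e/2. Thickening [K] by
    a small annihilator gives a union of cosets between [K] and [U]; its indicator is a combination
    of [V'], and the projection does at least as well. *)
Lemma proj_approx V (A : set (borel_type G)) (e : R) : dual_group V ->
  measurable A -> 0 < e ->
  exists V', [/\ dual_group V', {subset V <= V'} &
    I (fun x => (ind A x - fproj mu V' (ind A) x) ^+ 2) <= e].
Proof.
move=> hV mA e0.
have e2 : 0 < e / 2 by rewrite divr_gt0.
have [U [oU AU IU]] := open_outer haar mA e2.
have [K [cK KU IK]] := compact_inner haar haus oU e2.
have [V' [hV' VV' ann]] := annihilator_near hV (compact_shift_near cK oU KU).
exists V'; split=> //.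
pose Q := [pred p | `[< exists2 x, K x & pat V' x = p >]].
pose q y := \sum_(p | Q p) coset V' (rep p) y.
have hA : bdmeas (ind A) by exact: bdmeas_indic.
have hU : bdmeas (ind U) by apply: bdmeas_indic; exact: open_borel.
have hK : bdmeas (ind K) by apply: bdmeas_indic; exact: compact_borel.
pose c v := \sum_(p | Q p) (size V')%:R^-1 * v (rep p).
have qE y : q y = \sum_(v <- V') c v * v y.
  rewrite /q /coset -mulr_sumr exchange_big mulr_sumr; apply: eq_bigr => v _.
  by rewrite /c -mulr_sumr -mulrA mulr_suml.
apply: (le_trans (proj_best haar c hV' hA)).
have hq : bdmeas (fun x => \sum_(v <- V') c v * v x) by exact: bdmeas_comb.
apply: (@le_trans _ _ (I (fun y => (ind U y - ind K y) + (ind U y - ind A y)))).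
  apply: (le_mean haar); bdmeas_tac.
  move=> y; rewrite -qE /q sum_coset//; last by move=> p /asboolP[x _ <-]; exists x.
  rewrite !indicE.
  have h1 : (y \in K) ==> Q (pat V' y).
    by apply/implyP; rewrite inE => Ky; apply/asboolP; exists y.
  have h2 : Q (pat V' y) ==> (y \in U).
    apply/implyP => /asboolP[x Kx /eqP/(pat_eqP _ _ hV')/ann/(_ x Kx)].
    by rewrite inE addrA exp2 add0r.
  have h3 : (y \in (A : set G)) ==> (y \in U).
    by apply/implyP; rewrite !inE => /AU.
  by move: h1 h2 h3; do 3 case: (_ \in _); case: (Q _) => //=; lra.
rewrite (meanD haar) ?(meanB haar); bdmeas_tac.
lra.
Qed.

End Approximation.

(** * Subadditivity of {t}(1 - {t}) *)

Section FracPart.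
Variable R : realType.

Lemma fracpart_def (m : int) (t : R) : m%:~R <= t < (m + 1)%:~R ->
  fracpart t = t - m%:~R.
Proof. by move=> /floor_def E; rewrite /fracpart E. Qed.

Lemma fracpart_ge0_lt1 (t : R) : 0 <= fracpart t < 1.
Proof.
rewrite /fracpart; have /andP[a b] := floor_itv t; rewrite subr_ge0 a ltrBlDl.
by move: b; rewrite intrD addrC.
Qed.

(** With p = {s}, the right side exceeds the left by 2pb if p + b < 1, and by 2(1 - p)(1 - b)
    otherwise. *)
Lemma fracpart_subadd (s b : R) : 0 <= b <= 1 ->
  fracpart (s + b) * (1 - fracpart (s + b)) <=
  fracpart s * (1 - fracpart s) + b * (1 - b).
Proof.
move=> /andP[b0 b1]; have /andP[p0 p1] := fracpart_ge0_lt1 s.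
set p := fracpart s in p0 p1 *.
have sE : s - (Num.floor s)%:~R = p by [].
have [lt|ge] := ltP (p + b) 1.
  rewrite (@fracpart_def (Num.floor s)); last by rewrite intrD; lra.
  rewrite (_ : s + b - _ = p + b); last by lra.
  nra.
rewrite (@fracpart_def (Num.floor s + 1)); last by rewrite !intrD; lra.
rewrite (_ : s + b - _ = p + b - 1); last by rewrite intrD; lra.
nra.
Qed.

Lemma fracpart_sum (T : Type) (r : seq T) (P : pred T) (b : T -> R) :
  (forall i, P i -> 0 <= b i <= 1) ->
  let s := \sum_(i <- r | P i) b i in
  fracpart s * (1 - fracpart s) <= \sum_(i <- r | P i) b i * (1 - b i).
Proof.
move=> hb /=; elim: r => [|i r ih].
  by rewrite !big_nil (@fracpart_def 0) ?subr0 ?mul0r// lexx ltr01.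
rewrite !big_cons; case: ifPn => // Pi; rewrite addrC.
by apply: (le_trans (fracpart_subadd _ (hb _ Pi))); rewrite addrC lerD2l.
Qed.

End FracPart.

(** * A test function on a coset of non-integral density *)

Section TestFunction.
Variables (R : realType) (G : topologicalZmodType).
Variable mu : {measure set (borel_type G) -> \bar R}.
Hypothesis haar : is_haar_prob mu.
Implicit Types (f g h u v : G -> R) (V : seq (G -> R)).
Local Notation I := (mean mu).
Local Notation ind A := (\1_(A : set G) : G -> R).

(** The coset means of [f] sum to [I f] times |V|, so subadditivity bounds the sum of b(1 - b) over
    the cosets below by delta/|V|. *)
Lemma nonintegral_coset V f (delta : R) : dual_group V -> bdmeas f ->
  (forall x, 0 <= f x <= 1) -> 0 < delta ->
  (let t := I f * (size V)%:R in
    delta / (size V)%:R <= fracpart t * (1 - fracpart t)) ->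
  exists x, let b := fproj mu V f x in
    0 <= b <= 1 /\ delta / (2 * (size V)%:R ^+ 2) <= b * (1 - b).
Proof.
move=> hV hf f01 d0 /= hfrac.
have s0 : 0 < (size V)%:R :> R by rewrite ltr0n dual_group_size.
set n : R := (size V)%:R in s0 hfrac *.
pose Q := [pred p | `[< exists x, pat V x = p >]].
pose b (p : {ffun seq_sub V -> bool}) := fproj mu V f (rep p).
have hc x : bdmeas (coset V x) := bdmeas_coset x hV.
have part y : \sum_(p | Q p) coset V (rep p) y = 1.
  rewrite sum_coset//; last by move=> p /asboolP.
  by rewrite (_ : Q _ = true)//; apply/asboolP; exists y.
have cos01 x y : 0 <= coset V x y <= 1.
  by rewrite cosetE//; case: (_ == _); rewrite /= ?lexx ?ler01.
have b01 x : 0 <= fproj mu V f x <= 1.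
  rewrite (projE haar)// -/n; apply/andP; split.
    apply: mulr_ge0; first exact: ltW.
    apply: mean_ge0 => y; apply: mulr_ge0; first by have /andP[] := f01 y.
    by have /andP[] := cos01 x y.
  rewrite mulrC -ler_pdivlMr// mul1r -(mean_coset haar x hV); apply: (le_mean haar) => //.
    by bdmeas_tac.
  move=> y; have /andP[] := f01 y; have /andP[] := cos01 x y => ? ? ? ?.
  by rewrite ler_piMl.
(* The realised cosets partition the group and have mean 1/n each, so there are n of them. *)
have sum1 : \sum_(p | Q p) 1 = n.
  have : \sum_(p | Q p) I (coset V (rep p)) = 1.
    rewrite -(mean_sum haar); last by move=> p _; exact: hc.
    by rewrite -[RHS](mean_cst haar); apply: eq_mean => y; exact: part.
  rewrite (eq_bigr (fun=> n^-1 * 1)); last by move=> p _; rewrite mulr1 (mean_coset haar).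
  by rewrite -mulr_sumr => /(congr1 ( *%R n)); rewrite mulrA mulfV ?gt_eqF// mul1r mulr1.
have sumb : \sum_(p | Q p) b p = I f * n.
  rewrite (eq_bigr (fun p => n * fcoef mu f (coset V (rep p)))); last first.
    by move=> p _; rewrite /b (projE haar).
  rewrite -mulr_sumr mulrC; congr (_ * _); rewrite -(mean_sum haar).
    by apply: eq_mean => y; rewrite -mulr_sumr part mulr1.
  by move=> p _; have := hc (rep p) => ?; bdmeas_tac.
have := @fracpart_sum R _ (index_enum _) Q b (fun p _ => b01 (rep p)).
rewrite /= sumb => /(le_trans hfrac) hs.
apply: contrapT => no.
have : \sum_(p | Q p) b p * (1 - b p) <= \sum_(p | Q p) delta / (2 * n ^+ 2) * 1.
  apply: ler_sum => p _; rewrite mulr1 leNgt; apply/negP => /ltW lt.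
  by apply: no; exists (rep p).
rewrite -mulr_sumr sum1 => /(le_trans hs); rewrite leNgt => /negP; apply.
(* If all n cosets stayed below half the required average, the total would be at most half of
   delta/n. *)
rewrite (_ : delta / (2 * n ^+ 2) * n = delta / n / 2); last by field; rewrite gt_eqF.
have : 0 < delta / n by rewrite divr_gt0.
lra.
Qed.

Lemma test_function V (A : set (borel_type G)) (delta : R) (f := ind A) :
  dual_group V -> measurable A -> 0 < delta ->
  (let t := I f * (size V)%:R in
    delta / (size V)%:R <= fracpart t * (1 - fracpart t)) ->
  exists h, [/\ bdmeas h, (forall x, 0 <= h x), I h = 1,
    (forall x, h x <= 2 * (size V)%:R ^+ 3 / delta) &
    2^-1 <= `|fcoef mu f h - fcoef mu (fproj mu V f) h| ].
Proof.
move=> hV mA d0 hfrac.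
have s0 : 0 < (size V)%:R :> R by rewrite ltr0n dual_group_size.
have hf : bdmeas f by exact: bdmeas_indic.
have f01 x : f x = 0 \/ f x = 1.
  by rewrite /f indicE; case: (_ \in _); [right|left].
have [|x [/andP[b0 b1]]] := nonintegral_coset hV hf _ d0 hfrac.
  by move=> y; case: (f01 y) => ->; rewrite ?lexx ?ler01.
set b := fproj mu V f x in b0 b1 *.
set n : R := (size V)%:R in s0 hfrac * => bb.
have hc : bdmeas (coset V x) := bdmeas_coset x hV.
have hp : bdmeas (fproj mu V f) by exact: bdmeas_comb.
have c01 y : coset V x y = 0 \/ coset V x y = 1.
  by rewrite cosetE//; case: (_ == _); [right|left].
have pc y : fproj mu V f y * coset V x y = b * coset V x y.
  rewrite cosetE//; case: eqP => [E|_]; last by rewrite !mulr0.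
  rewrite !mulr1 /b !(projE haar)//; congr (_ * fcoef _ _ _); apply/funext => z.
  by rewrite !cosetE// E.
(* Here [k] is the indicator of [A] or of its complement, and [s] the value of [f] on its support;
   the density is [k] restricted to the coset and normalised. *)
have gen k s : bdmeas k -> (forall y, 0 <= k y <= 1) -> (forall y, f y * k y = s * k y) ->
   2^-1 <= `|s - b| -> delta / (2 * n ^+ 3) <= fcoef mu k (coset V x) ->
   exists h, [/\ bdmeas h, (forall x, 0 <= h x), I h = 1,
    (forall x, h x <= 2 * n ^+ 3 / delta) &
    2^-1 <= `|fcoef mu f h - fcoef mu (fproj mu V f) h| ].
  move=> hk k01 fk sb; set m := fcoef mu k _ => dm.
  have q0 : 0 < delta / (2 * n ^+ 3) by rewrite divr_gt0 ?mulr_gt0 ?exprn_gt0.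
  have m0 : 0 < m by exact: lt_le_trans dm.
  have hkc : bdmeas (fun y => k y * coset V x y) by bdmeas_tac.
  exists (fun y => m^-1 * (k y * coset V x y)); split.
  - by bdmeas_tac.
  - move=> y; apply: mulr_ge0; first by rewrite invr_ge0 ltW.
    apply: mulr_ge0; first by have /andP[] := k01 y.
    by case: (c01 y) => ->.
  - by rewrite meanZ// mulVf// gt_eqF.
  - move=> y; apply: (@le_trans _ _ (m^-1 * 1)).
      rewrite ler_pM2l ?invr_gt0//; have /andP[k0 k1] := k01 y.
      by case: (c01 y) => ->; rewrite ?mulr0 ?mulr1// ler01.
    rewrite mulr1 (_ : 2 * n ^+ 3 / delta = (delta / (2 * n ^+ 3))^-1).
      by rewrite lef_pV2.
    by rewrite invf_div.
  - have -> : fcoef mu f (fun y => m^-1 * (k y * coset V x y)) = s.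
      transitivity (I (fun y => (s / m) * (k y * coset V x y))).
        apply: eq_mean => y; transitivity (m^-1 * (f y * k y) * coset V x y); first by ring.
        by rewrite fk; ring.
      by rewrite meanZ// -/(fcoef mu k (coset V x)) -/m divfK// gt_eqF.
    have -> : fcoef mu (fproj mu V f) (fun y => m^-1 * (k y * coset V x y)) = b.
      transitivity (I (fun y => (b / m) * (k y * coset V x y))).
        apply: eq_mean => y.
        transitivity (m^-1 * k y * (fproj mu V f y * coset V x y)); first by ring.
        by rewrite pc; ring.
      by rewrite meanZ// -/(fcoef mu k (coset V x)) -/m divfK// gt_eqF.
    by [].
have cb : fcoef mu f (coset V x) = b / n.
  by rewrite /b (projE haar)// -/n mulrC mulKf// gt_eqF.
have dn : delta / (2 * n ^+ 3) = delta / (2 * n ^+ 2) / n by field; rewrite gt_eqF.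
(* Choosing the side on which [f] is farther from [b] gives a gap of at least 1/2; either side has
   relative density at least b(1 - b). *)
have [le|gt] := lerP b 2^-1.
  apply: (gen f 1) => //.
  - by move=> y; case: (f01 y) => ->; rewrite ?lexx ?ler01.
  - by move=> y; case: (f01 y) => ->; rewrite ?mulr0 ?mulr1.
  - by rewrite ger0_norm; lra.
  - rewrite cb dn ler_pM2r ?invr_gt0//; apply: (le_trans bb); nra.
apply: (gen (fun y => 1 - f y) 0) => //.
- by bdmeas_tac.
- by move=> y; case: (f01 y) => ->; lra.
- by move=> y; case: (f01 y) => ->; lra.
- by rewrite sub0r normrN ger0_norm; lra.
- have -> : fcoef mu (fun y => 1 - f y) (coset V x) = (1 - b) / n.
    rewrite fcoefBl//; bdmeas_tac.
    rewrite cb mulrBl mul1r; congr (_ - _); rewrite -(mean_coset haar x hV).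
    by apply: eq_mean => y; rewrite mul1r.
  rewrite dn ler_pM2r ?invr_gt0//; apply: (le_trans bb); nra.
Qed.

End TestFunction.

(** * Chang's theorem *)

Section Chang.
Variables (R : realType) (G : topologicalZmodType).
Variable mu : {measure set (borel_type G) -> \bar R}.
Hypothesis haar : is_haar_prob mu.
Implicit Types (f g h u v : G -> R) (V : seq (G -> R)).
Local Notation I := (mean mu).

(** From exp(2y^2 - y) >= 1 + 2y^2 - y and (1 + y)(1 - y + 2y^2) = 1 + y^2(1 + 2y) >= 1. *)
Lemma expR_le1D (y : R) : - 2^-1 <= y -> expR (y - 2 * y ^+ 2) <= 1 + y.
Proof.
move=> hy; rewrite (_ : y - 2 * y ^+ 2 = - (2 * y ^+ 2 - y)); last by ring.
rewrite expRN -[leLHS]mul1r ler_pdivrMr ?expR_gt0//.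
have h := expR_ge1Dx (2 * y ^+ 2 - y).
have y1 : 0 <= 1 + y by lra.
apply: (le_trans _ (ler_wpM2l y1 h)).
have y2 := sqr_ge0 y; nra.
Qed.

Lemma chang V h (L rho : R) : dual_group V -> bdmeas h -> (forall x, 0 <= h x) ->
  I h = 1 -> (forall x, h x <= expR L) -> 0 < rho <= 1 ->
  exists V' k, [/\ dual_group V', {subset V <= V'}, size V' = (size V * 2 ^ k)%N,
    k%:R * (rho ^+ 2 / 8) <= L &
    forall g, character g -> rho <= `|fcoef mu h g| -> g \in V'].
Proof.
move=> hV hh h0 h1 hL /andP[r0 r1]; apply: contrapT => no.
(* Greedy choice of characters: P is the Riesz product of the k characters added
   so far and Q a minorant of log P that is affine in them. *)
pose state k := exists V' P Q,
  [/\ dual_group V', {subset V <= V'} & size V' = (size V * 2 ^ k)%N] /\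
  [/\ bdmeas P, bdmeas Q, I P = 1, (forall x, expR (Q x) <= P x) &
      (forall g, character g -> g \notin V' -> fcoef mu P g = 0) /\
      k%:R * (rho ^+ 2 / 8) <= fcoef mu h Q].
(* Jensen's inequality for the density h bounds the number of greedy steps. *)
have jensen k : state k -> k%:R * (rho ^+ 2 / 8) <= L.
  move=> [V' [P [Q [_ [hP hQ IP QP [_ kQ]]]]]]; apply: (le_trans kQ).
  set m := fcoef mu h Q; rewrite -ler_expR.
  apply: (@le_trans _ _ (I (fun x => h x * P x))).
    (* The tangent line of exp at [m], integrated against [h], gives exactly exp(m). *)
    have -> : expR m = I (fun x => expR m * (h x * (1 + Q x - m))).
      rewrite meanZ//; last by bdmeas_tac.
      rewrite (_ : I _ = 1) ?mulr1//.
      transitivity ((1 - m) * I h + fcoef mu h Q); last by rewrite h1 /m; ring.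
      rewrite -(meanZ haar) -?(meanD haar); bdmeas_tac.
      by apply: eq_mean => x; ring.
    apply: (le_mean haar); bdmeas_tac.
    move=> x; rewrite mulrCA ler_wpM2l//; apply: le_trans (QP x).
    rewrite (_ : Q x = m + (Q x - m)); last by ring.
    rewrite expRD ler_pM2l ?expR_gt0//; apply: le_trans (expR_ge1Dx _).
    by lra.
  rewrite -[leRHS]mulr1 -IP -(meanZ haar)//; apply: (le_mean haar); bdmeas_tac.
  by move=> x; rewrite ler_wpM2r// (le_trans _ (QP x))// expR_ge0.
have stateP k : state k.
  elim: k => [|k ih].
    exists V, (fun=> 1), (fun=> 0); split; first by split=> //; rewrite muln1.
    split; [exact: bdmeas_cst|exact: bdmeas_cst|exact: mean_cst|by rewrite expR0|split].
      move=> g hg gV; rewrite -[RHS](mean_character haar hg); last first.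
        by move=> E; move: gV; rewrite E; case: hV => _ _ ->.
      by apply: eq_mean => x; rewrite mul1r.
    by rewrite mul0r /fcoef mean_ge0// => x; rewrite mulr0.
  have kL := jensen k ih.
  have [V' [P [Q [[hV' VV' sV'] [hP hQ IP QP [orth kQ]]]]]] := ih.
  have [g [hg gr gV']] : exists g, [/\ character g, rho <= `|fcoef mu h g| & g \notin V'].
    apply: contrapT => h'; apply: no; exists V', k; split=> // g hg gr.
    by apply: contraT => gV'; case: h'; exists g.
  have hgm := bdmeas_character hg.
  pose s : R := if 0 <= fcoef mu h g then 1 else -1.
  have s2 : s ^+ 2 = 1 by rewrite /s; case: ifP; rewrite ?sqrrN expr1n.
  have sg : s * fcoef mu h g = `|fcoef mu h g|.
    by rewrite /s; case: ifPn => [c0|]; [rewrite ger0_norm ?mul1r|rewrite -ltNge => c0; rewrite ltr0_norm ?mulN1r].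
  (* This maximises the gain t rho - 2t^2, with value rho^2/8. *)
  pose t := rho / 4.
  have t0 : 0 < t by rewrite divr_gt0.
  have tg x : (t * s * g x) ^+ 2 = t ^+ 2.
    by rewrite !exprMn s2 (expr2 (g x)) character_sqr// !mulr1.
  have tgl x : - 2^-1 <= t * s * g x.
    have : `|t * s * g x| <= 2^-1.
      rewrite -(@ler_sqr _ _ 2^-1) ?nnegrE//.
      rewrite real_normK ?num_real// tg ler_sqr ?nnegrE ?(ltW t0)// /t; lra.
    by rewrite ler_norml => /andP[].
  exists (adjoin V' g), (fun x => P x * (1 + t * s * g x)),
    (fun x => Q x + (t * s * g x - 2 * t ^+ 2)).
  split.
    split; first exact: dual_group_adjoin.
    - by move=> v /VV'; exact: sub_adjoin.
    - by rewrite size_adjoin sV' expnS mulnCA.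
  split; [by bdmeas_tac|by bdmeas_tac| | |split].
  - transitivity (I P + t * s * fcoef mu P g).
      rewrite -(meanZ haar) -?(meanD haar); bdmeas_tac.
      by apply: eq_mean => x; ring.
    by rewrite orth// mulr0 addr0.
  - move=> x; rewrite expRD; apply: ler_pM; rewrite ?expR_ge0//.
    by rewrite -(tg x); exact: expR_le1D.
  (* The new factor mixes the coefficients of [P] at [g'] and [g' g], both outside the old
     subgroup. *)
  - move=> g' hg'; rewrite mem_adjoin// negb_or => /andP[g'V' gg'V'].
    have hgm' := bdmeas_character hg'.
    transitivity (fcoef mu P g' + t * s * fcoef mu P (cmul g' g)).
      rewrite /fcoef /cmul -(meanZ haar) -?(meanD haar); bdmeas_tac.
      by apply: eq_mean => x; ring.
    by rewrite !orth// ?mulr0 ?addr0//; exact: characterM.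
  - have -> : fcoef mu h (fun x => Q x + (t * s * g x - 2 * t ^+ 2)) =
       fcoef mu h Q + (t * (s * fcoef mu h g) - 2 * t ^+ 2 * I h).
      rewrite mulrA /fcoef -!(meanZ haar) -?(meanB haar) -?(meanD haar); bdmeas_tac.
      by apply: eq_mean => x; ring.
    rewrite sg h1 mulr1 -natr1 mulrDl mul1r lerD//.
    have : t * rho <= t * `|fcoef mu h g| by rewrite ler_pM2l.
    rewrite /t; lra.
have r8 : 0 < rho ^+ 2 / 8 by rewrite divr_gt0 ?exprn_gt0.
have := jensen _ (stateP (Num.truncn (L / (rho ^+ 2 / 8))).+1).
rewrite -ler_pdivlMr// leNgt => /negP; apply.
exact: truncnS_gt.
Qed.

Lemma sum_subset (T : choiceType) (s t : seq T) (P Q : pred T) (F : T -> R) :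
  uniq s -> uniq t -> (forall x, 0 <= F x) ->
  (forall x, x \in s -> P x -> x \in t /\ Q x) ->
  \sum_(x <- s | P x) F x <= \sum_(x <- t | Q x) F x.
Proof.
move=> us ut F0 sub.
rewrite [leRHS](bigID (fun x => (x \in s) && P x)) /=.
apply: (@le_trans _ _ (\sum_(x <- t | Q x && ((x \in s) && P x)) F x)); last first.
  by rewrite lerDl sumr_ge0.
rewrite -big_filter -[leRHS]big_filter (perm_big [seq x <- t | Q x && ((x \in s) && P x)])//.
apply: uniq_perm; rewrite ?filter_uniq// => x; rewrite !mem_filter.
apply/andP/andP => [[Px xs]|[/andP[Qx /andP[xs Px]] xt]] //.
by have [xt ->] := sub x xs Px; rewrite xs Px.
Qed.

Lemma sum_dyadic n : \sum_(i < n) (1 + i%:R) * 2^-1 ^+ i <= 4 :> R.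
Proof.
suff -> : \sum_(i < n) (1 + i%:R) * 2^-1 ^+ i = 4 - (2 * n%:R + 4) * 2^-1 ^+ n :> R.
  by rewrite lerBlDr lerDl mulr_ge0 ?exprn_ge0// addr_ge0 ?mulr_ge0.
elim: n => [|n ih]; first by rewrite big_ord0 expr0; ring.
by rewrite big_ord_recr /= ih -natr1 exprS; field.
Qed.

(** Either [a] is at most 2^-n, or the upper end of its dyadic interval is one of the summands. *)
Lemma dyadic_bound (a : R) n : 0 <= a <= 1 ->
  a <= \sum_(i < n | 2^-1 ^+ i.+1 <= a) 2^-1 ^+ i + 2^-1 ^+ n.
Proof.
move=> /andP[a0 a1]; elim: n => [|n ih]; first by rewrite big_ord0 add0r expr0.
rewrite big_mkcond big_ord_recr -big_mkcond /=.
have h0 : 0 <= 2^-1 ^+ n.+1 :> R by rewrite exprn_ge0.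
have s0 : 0 <= \sum_(i < n | 2^-1 ^+ i.+1 <= a) (2^-1 ^+ i : R).
  by apply: sumr_ge0 => i _; rewrite exprn_ge0.
by case: ifPn => [_|]; [|rewrite -ltNge => /ltW]; lra.
Qed.

Lemma fcoef_le1 h g : bdmeas h -> (forall x, 0 <= h x) -> I h = 1 -> character g ->
  `|fcoef mu h g| <= 1.
Proof.
move=> hh h0 h1 hg; have hgm := bdmeas_character hg.
rewrite -h1; apply: (le_trans (norm_mean haar _)); first by bdmeas_tac.
rewrite le_eqVlt; apply/orP; left; apply/eqP; apply: eq_mean => x.
by rewrite normrM; have [_ _ ->] := hg; rewrite mulr1 ger0_norm.
Qed.

Lemma spectral_gain V W f h (L : R) : dual_group V -> dual_group W ->
  {subset V <= W} -> bdmeas h -> (forall x, 0 <= h x) ->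
  I h = 1 -> (forall x, h x <= expR L) ->
  4^-1 <= \sum_(g <- W | g \notin V) `|fcoef mu f g| * `|fcoef mu h g| ->
  exists V' k i, [/\ dual_group V', {subset V <= V'}, size V' = (size V * 2 ^ k)%N,
    k%:R <= 32 * 4 ^+ i * L &
    (1 + i%:R) / 32 <= \sum_(g <- V' | g \notin V) `|fcoef mu f g|].
Proof.
move=> hV hW VW hh h0 h1 hL big; apply: contrapT => no.
have [uW cW _ _] := hW.
have half01 i : 0 < (2^-1 : R) ^+ i <= 1.
  by rewrite exprn_gt0//= exprn_ile1//; lra.
have level i : \sum_(g <- W | (g \notin V) && (2^-1 ^+ i.+1 <= `|fcoef mu h g|))
    `|fcoef mu f g| <= (1 + i%:R) / 32.
  have [V' [k [hV' VV' sV' kL spec]]] := chang hV hh h0 h1 hL (half01 i.+1).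
  apply: (@le_trans _ _ (\sum_(g <- V' | g \notin V) `|fcoef mu f g|)).
    have [uV' _ _ _] := hV'.
    apply: sum_subset => // g gW /andP[gV gr]; split=> //.
    by apply: spec => //; exact: cW.
  rewrite leNgt; apply/negP => /ltW gt; apply: no; exists V', k, i; split=> //.
  (* At threshold rho = 2^-(i+1), the factor 8/rho^2 from Chang's theorem is 32 * 4^i. *)
  have E : (2 : R)^-1 ^+ i.+1 ^+ 2 * 4 ^+ i.+1 = 1.
    by rewrite exprAC -exprMn (_ : _ * 4 = 1 :> R) ?expr1n//; field.
  have f0 : 0 < 32 * (4 : R) ^+ i by rewrite mulr_gt0// exprn_gt0.
  move: kL; rewrite -(ler_pM2l f0); apply: le_trans.
  rewrite (_ : 32 * 4 ^+ i * _ = k%:R * (2^-1 ^+ i.+1 ^+ 2 * 4 ^+ i.+1)).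
    by rewrite E mulr1.
  by rewrite [4 ^+ i.+1]exprS; field.
pose K := \sum_(g <- W | g \notin V) `|fcoef mu f g|.
have K0 : 0 <= K by apply: sumr_ge0.
(* Enough levels to make the tail K/2^n less than 1/16. *)
pose n := (Num.truncn (16 * K)).+1.
have nK : 16 * K < 2 ^+ n.
  apply: (lt_trans (truncnS_gt _)); rewrite -/n -natrX ltr_nat; exact: ltn_expl.
clearbody n.
have : \sum_(g <- W | g \notin V) `|fcoef mu f g| * `|fcoef mu h g| <=
   \sum_(i < n) 2^-1 ^+ i * ((1 + i%:R) / 32) + K * 2^-1 ^+ n.
  apply: (@le_trans _ _ (\sum_(g <- W | g \notin V) `|fcoef mu f g| *
     (\sum_(i < n | 2^-1 ^+ i.+1 <= `|fcoef mu h g|) 2^-1 ^+ i + 2^-1 ^+ n))).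
    rewrite big_seq_cond [leRHS]big_seq_cond; apply: ler_sum => g /andP[gW _].
    apply: ler_wpM2l => //; apply: dyadic_bound; rewrite normr_ge0 /=.
    by apply: fcoef_le1 => //; exact: cW.
  rewrite (eq_bigr (fun g => \sum_(i < n) (if 2^-1 ^+ i.+1 <= `|fcoef mu h g| then
     2^-1 ^+ i * `|fcoef mu f g| else 0) + `|fcoef mu f g| * 2^-1 ^+ n)); last first.
    move=> g _; rewrite mulrDr mulr_sumr -big_mkcond /=; congr (_ + _).
    by apply: eq_bigr => i _; rewrite mulrC.
  rewrite big_split -mulr_suml /= lerD2r exchange_big /=; apply: ler_sum => i _.
  rewrite -big_mkcondr -mulr_sumr ler_pM2l ?exprn_gt0//.
move=> /(le_trans big); rewrite leNgt => /negP; apply.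
have -> : \sum_(i < n) 2^-1 ^+ i * ((1 + i%:R) / 32) =
   (\sum_(i < n) (1 + i%:R) * 2^-1 ^+ i) / 32 :> R.
  by rewrite mulr_suml; apply: eq_bigr => i _; ring.
(* The levels give at most 4/32 and the tail less than 1/16, in total below 1/4. *)
have := sum_dyadic n.
have : K * 2^-1 ^+ n < 1 / 16.
  rewrite exprVn ltr_pdivrMr ?exprn_gt0//.
  move: nK; set N := 2 ^+ n; lra.
lra.
Qed.

End Chang.

(** * The iteration *)

Section Iteration.
Variables (R : realType) (G : topologicalZmodType).
Variable mu : {measure set (borel_type G) -> \bar R}.
Hypothesis haar : is_haar_prob mu.
Hypothesis haus : hausdorff_space G.
Hypothesis cpt : compact [set: G].
Hypothesis exp2 : forall x : G, x + x = 0.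
Implicit Types (f g h u v : G -> R) (V : seq (G -> R)).
Local Notation I := (mean mu).
Local Notation ind A := (\1_(A : set G) : G -> R).

(** The auxiliary subgroup [W], of uncontrolled size, only turns the pairing of [f] with [h] into a
    finite sum; the size of [V'] is controlled by Chang's theorem alone. *)
Lemma gain_step V (A : set (borel_type G)) (delta : R) (f := ind A) :
  dual_group V -> measurable A -> 0 < delta ->
  (let t := I f * (size V)%:R in
    delta / (size V)%:R <= fracpart t * (1 - fracpart t)) ->
  exists V' k i, [/\ dual_group V', {subset V <= V'}, size V' = (size V * 2 ^ k)%N,
    k%:R <= 32 * 4 ^+ i * ln (2 * (size V)%:R ^+ 3 / delta) &
    (1 + i%:R) / 32 <= \sum_(g <- V' | g \notin V) `|fcoef mu f g|].
Proof.
move=> hV mA d0 hfrac.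
have s0 : 0 < (size V)%:R :> R by rewrite ltr0n dual_group_size.
have [h [hh h0 h1 hH htest]] := test_function haar hV mA d0 hfrac.
set H := 2 * _ / _ in hH *.
have H0 : 0 < H by rewrite divr_gt0// mulr_gt0 ?exprn_gt0.
have hf : bdmeas f by exact: bdmeas_indic.
(* From |u| <= e + u^2/e and h <= H, an L2 error of at most e changes the pairing by at most 2He =
   1/4, leaving 1/4 of the gap 1/2. *)
pose e : R := (8 * H)^-1.
have e0 : 0 < e by rewrite invr_gt0 mulr_gt0.
have [|W [hW VW IW]] := proj_approx haar haus cpt exp2 hV mA (_ : 0 < e ^+ 2).
  by rewrite exprn_gt0.
rewrite -/f in IW.
have hpW : bdmeas (fproj mu W f) by exact: bdmeas_comb.
have hpV : bdmeas (fproj mu V f) by exact: bdmeas_comb.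
have close : `|fcoef mu f h - fcoef mu (fproj mu W f) h| <= 4^-1.
  rewrite -fcoefBl// /fcoef; apply: (le_trans (norm_mean haar _)); first by bdmeas_tac.
  apply: (@le_trans _ _ (I (fun x => H * (e + e^-1 * (f x - fproj mu W f x) ^+ 2)))).
    apply: (le_mean haar); bdmeas_tac.
    move=> x; rewrite normrM (ger0_norm (h0 x)) mulrC.
    apply: ler_pM => //; set u := f x - _.
    have := sqr_ge0 (`|u| - e); rewrite sqrrB real_normK ?num_real// => uu.
    rewrite -(ler_pM2l e0) mulrDr mulrA mulfV ?gt_eqF// mul1r.
    have := normr_ge0 u; nra.
  rewrite meanZ ?meanD ?meanZ ?mean_cst//; bdmeas_tac.
  have : e^-1 * I (fun x => (f x - fproj mu W f x) ^+ 2) <= e.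
    by rewrite mulrC ler_pdivrMr// -expr2.
  rewrite -(ler_pM2l H0).
  have : H * e = 8^-1 by rewrite /e; field; rewrite gt_eqF.
  lra.
apply: (spectral_gain haar hV hW VW hh h0 h1 (L := ln H)).
  by move=> x; rewrite lnK.
have [uV cV _ _] := hV; have [uW cW _ _] := hW.
apply: (@le_trans _ _ `|\sum_(g <- W | g \notin V) fcoef mu f g * fcoef mu g h|); last first.
  apply: (le_trans (ler_norm_sum _ _ _)); apply: ler_sum => g _.
  by rewrite normrM [fcoef mu g h]fcoefC.
have -> : \sum_(g <- W | g \notin V) fcoef mu f g * fcoef mu g h =
   fcoef mu (fproj mu W f) h - fcoef mu (fproj mu V f) h.
  rewrite !fcoef_comb// [X in _ = X - _](bigID (fun g => g \in V)) /= addrAC.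
  rewrite (_ : \sum_(g <- W | g \in V) _ = \sum_(g <- V) fcoef mu f g * fcoef mu g h).
    by rewrite subrr add0r.
  rewrite -big_filter; apply: perm_big; apply: uniq_perm; rewrite ?filter_uniq//.
  by move=> g; rewrite mem_filter andb_idr// => /VW.
move: htest close; set a := fcoef mu f h; set b := fcoef mu _ h; set c := fcoef mu _ h.
have := ler_normD (a - c) (c - b); rewrite subrKA; lra.
Qed.

Definition mass f V : R := \sum_(v <- V) `|fcoef mu f v|.

(** [B] is chosen so that a step multiplies 1 + ln |V| by at most B^(1+i), and [c] so that the
    resulting increase of c ln(1 + ln |V|) is at most the mass gained, (1 + i)/32. *)
Lemma mass_growth (A : set (borel_type G)) (delta M : R) (f := ind A)
    (B := 1 + 32 * (4 + `|ln delta|)) (c := (32 * ln B)^-1) :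
  measurable A -> 0 < delta -> 16 <= M ->
  (forall V, dual_group V -> (size V)%:R <= M -> let t := I f * (size V)%:R in
    delta / (size V)%:R <= fracpart t * (1 - fracpart t)) ->
  exists2 V, dual_group V & c * ln (ln M) <= mass f V.
Proof.
move=> mA d0 M16 hyp.
have B4 : 4 <= B by have := normr_ge0 (ln delta); rewrite /B; lra.
have lB : 0 < ln B by rewrite ln_gt0//; lra.
have c0 : 0 < c by rewrite invr_gt0 mulr_gt0.
apply: contrapT => no.
have mass_lt V : dual_group V -> mass f V < c * ln (ln M).
  by move=> hV; rewrite ltNge; apply/negP => le; apply: no; exists V.
(* The third clause gives the conclusion once the order passes [M]; the fourth forces the mass past
   any bound if it never does. *)
have iter n : exists V, [/\ dual_group V, (size V)%:R <= M,
    c * ln (1 + ln (size V)%:R) <= mass f V & n%:R / 32 <= mass f V].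
  elim: n => [|n [V [hV sM mV nV]]].
    exists [:: fun=> 1]; have m0 : 0 <= mass f [:: fun=> 1] by exact: sumr_ge0.
    split; [exact: dual_group1|by rewrite /=; lra| |by rewrite mul0r].
    by rewrite /= ln1 addr0 ln1 mulr0.
  have [V' [k [i [hV' VV' sV' kL gain]]]] := gain_step hV mA d0 (hyp V hV sM).
  have s1 : 1 <= (size V)%:R :> R by rewrite (ler_nat _ 1) dual_group_size.
  have s0 : 0 < (size V)%:R :> R by apply: lt_le_trans s1.
  have l0 : 0 <= ln (size V)%:R :> R by rewrite ln_ge0.
  have massE : mass f V + (1 + i%:R) / 32 <= mass f V'.
    rewrite [leRHS]/mass (bigID (fun g => g \in V)) /= lerD//.
    have [uV _ _ _] := hV; have [uV' _ _ _] := hV'.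
    by apply: sum_subset => // g gV _; split=> //; exact: VV'.
  have i0 : 0 <= i%:R :> R by rewrite ler0n.
  have ln21 : ln 2 <= 1 :> R.
    by have := @le_ln1Dx R 1; rewrite (_ : 1 + 1 = 2 :> R); [apply; lra|ring].
  have ln20 : 0 <= ln 2 :> R by rewrite ln_ge0//; lra.
  have D1 : c * ln (1 + ln (size V')%:R) <= mass f V'.
    apply: le_trans massE.
    have -> : (1 + i%:R) / 32 = c * ((1 + i%:R) * ln B).
      by rewrite /c; field; rewrite gt_eqF.
    apply: le_trans (lerD mV (lexx _)); rewrite -mulrDr ler_pM2l//.
    set D := 1 + ln (size V)%:R.
    have D1 : 1 <= D by rewrite /D; lra.
    have D0 : 0 < D by lra.
    have -> : (1 + i%:R) * ln B = ln (B ^+ i.+1).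
      by rewrite lnXn ?mulr_natl -?natr1 1?addrC//; lra.
    have Bi : 0 < B ^+ i.+1 by rewrite exprn_gt0//; lra.
    rewrite -lnM ?posrE//.
    have lV' : ln (size V')%:R = ln (size V)%:R + k%:R * ln 2 :> R.
      by rewrite sV' natrM natrX lnM ?posrE ?exprn_gt0// lnXn// mulr_natl.
    have k0 : 0 <= k%:R :> R by rewrite ler0n.
    rewrite ler_ln ?posrE ?mulr_gt0//; last by rewrite lV'; have := mulr_ge0 k0 ln20; lra.
    rewrite lV'.
    have LE : ln (2 * (size V)%:R ^+ 3 / delta) = ln 2 + 3 * ln (size V)%:R - ln delta.
      rewrite ln_div ?posrE ?mulr_gt0 ?exprn_gt0// lnM ?posrE ?exprn_gt0//.
      by rewrite lnXn// mulr_natl.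
    have LB : ln (2 * (size V)%:R ^+ 3 / delta) <= (4 + `|ln delta|) * D.
      rewrite LE; have := ler_norm (- ln delta); rewrite normrN /D.
      have := mulr_ge0 (normr_ge0 (ln delta)) l0; lra.
    have p4 : 1 <= (4 : R) ^+ i by rewrite exprn_ege1//; lra.
    have kB : k%:R <= 32 * 4 ^+ i * ((4 + `|ln delta|) * D).
      by apply: (le_trans kL); rewrite ler_pM2l// mulr_gt0//; lra.
    have k2 : k%:R * ln 2 <= k%:R :> R by rewrite ler_piMr.
    (* The two summands of [B] absorb [D] and the bound on [k]; then B >= 4 absorbs 4^i. *)
    apply: (@le_trans _ _ (4 ^+ i * (D * B))).
      have DD : D <= 4 ^+ i * D by rewrite ler_peMl//; lra.
      rewrite /B; rewrite /D in DD kB *; lra.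
    have B0 : 0 <= B by lra.
    have BiX : 4 ^+ i <= B ^+ i by rewrite lerXn2r ?nnegrE.
    rewrite exprS [leRHS]mulrA [leLHS]mulrC ler_wpM2l// mulr_ge0//; exact: ltW.
  exists V'; split=> //.
  - rewrite leNgt; apply/negP => gtM; have := mass_lt _ hV'; rewrite ltNge => /negP; apply.
    apply: le_trans D1; rewrite ler_pM2l//.
    have lM : 0 < ln M by rewrite ln_gt0//; lra.
    have M0 : 0 < M by lra.
    have lt : ln M <= ln (size V')%:R by rewrite ler_ln ?posrE ?ltW// (lt_trans M0).
    by rewrite ler_ln ?posrE//; lra.
  - apply: le_trans massE; rewrite -natr1; lra.
(* So many steps already force mass above c ln ln M, contradicting [no]. *)
have [V [hV _ _ mV]] := iter (Num.truncn (32 * (c * ln (ln M)))).+1.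
have := mass_lt _ hV; have := @truncnS_gt R (32 * (c * ln (ln M))); lra.
Qed.

Lemma Anorm_ge_mass V f : dual_group V -> bdmeas f -> ((mass f V)%:E <= Anorm mu f)%E.
Proof.
move=> [uV cV _ _] hf; apply: esum_ge; exists [set` V].
  split; first exact: finite_seq.
  by move=> v /= /cV.
rewrite -fsbig_seq// /mass -sumEFin big_seq [leRHS]big_seq; apply: lee_sum => v vV.
have hv := bdmeas_character (cV _ vV).
by rewrite /fourier (meanE haar (bdmeasM hf hv)).
Qed.

End Iteration.

Theorem theorem6p1 (R : realType) (delta : R) (hdelta : 0 < delta) :
  exists c : R, 0 < c /\
  forall (G : topologicalZmodType)
         (mu : {measure set (borel_type G) -> \bar R})
         (M : R) (A : set (borel_type G)) (alpha : R),
    hausdorff_space G ->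
    compact [set: G] ->
    (forall x : G, x + x = 0) ->
    is_haar_prob mu ->
    16 <= M ->
    measurable A ->
    mu A = alpha%:E ->
    (forall (I : finType) (phi : I -> G -> R),
        finite_dual_subgroup phi ->
        (#|I|%:R <= M) ->
        fracpart (alpha * #|I|%:R) * (1 - fracpart (alpha * #|I|%:R)) >= delta / #|I|%:R) ->
    (Anorm mu (\1_A) >= (c * ln (ln M))%:E)%E.
Proof.
exists (32 * ln (1 + 32 * (4 + `|ln delta|)))^-1; split.
  by rewrite invr_gt0 mulr_gt0// ln_gt0//; have := normr_ge0 (ln delta); lra.
move=> G mu M A alpha haus cpt exp2 haar M16 mA muA hyp.
have [|V hV] := @mass_growth R G mu haar haus cpt exp2 A delta M mA hdelta M16.
  move=> V hV sM /=; rewrite mean_indic// muA /=.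
  have [uV cV V1 VM] := hV.
  have := hyp (seq_sub V) (@ssval _ V).
  rewrite card_seq_sub//; apply=> //; split.
  - exact: val_inj.
  - by move=> i; apply: cV; exact: ssvalP.
  - by exists (SeqSub V1).
  - by move=> i j; exists (SeqSub (VM _ _ (ssvalP i) (ssvalP j))).
rewrite -lee_fin => /le_trans; apply; apply: Anorm_ge_mass => //; exact: bdmeas_indic.
Qed.
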